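(* Let $K$ be a number field and let $(\mathcal{O};\mathfrak{m},\Sigma)$ and $(\mathcal{O}';\mathfrak{m}',\Sigma')$ be level data for $K$ with $\mathcal{O}\subseteq\mathcal{O}'$, $\mathfrak{m}\mathcal{O}'\subseteq\mathfrak{m}'$ and $\Sigma\supseteq\Sigma'$. Let $\mathfrak{d}$ be any $\mathcal{O}'$-ideal with $\mathfrak{d}\subseteq(\mathfrak{m}:\mathcal{O}')$. Then there is an exact sequence $$1\to\frac{U_{\mathfrak{m}',\Sigma'}(\mathcal{O}')}{U_{\mathfrak{m},\Sigma}(\mathcal{O})}\to\frac{U_{\mathfrak{m}'}(\mathcal{O}'/\mathfrak{d})}{U_{\mathfrak{m}}(\mathcal{O}/\mathfrak{d})}\times\{\pm1\}^{|\Sigma\setminus\Sigma'|}\to\mathrm{Cl}_{\mathfrak{m},\Sigma}(\mathcal{O})\to\mathrm{Cl}_{\mathfrak{m}',\Sigma'}(\mathcal{O}')\to1.$$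
   Context: A level datum $(\mathcal{O};\mathfrak{m},\Sigma)$ for $K$ consists of an order $\mathcal{O}$ of $K$ (subring containing 1, free $\mathbb Z$-module of rank $[K:\mathbb Q]$), a nonzero integral $\mathcal{O}$-ideal $\mathfrak{m}$ and a set $\Sigma$ of real embeddings of $K$. $(\mathfrak a:\mathfrak b)=\{x\in K: x\mathfrak b\subseteq\mathfrak a\}$. For a commutative ring $R$ and ideal $I$: $U_I(R)=\{\alpha\in R^\times:\alpha\equiv1\pmod I\}$, and if $R\subseteq K$, $U_{I,\Sigma}(R)=\{\alpha\in U_I(R):\rho(\alpha)>0\ \forall\rho\in\Sigma\}$; when an ideal $I$ of a ring $R_1$ is used with a ring $R_2$ receiving a natural map from $R_1$, $U_I(R_2)$ means $U_{IR_2}(R_2)$ (so $U_{\mathfrak m'}(\mathcal O'/\mathfrak d)$ is the group of units of $\mathcal O'/\mathfrak d$ congruent to $1$ modulo the image of $\mathfrak m'$; note $\mathfrak d$ is also an $\mathcal O$-ideal). The quotients are taken via the natural inclusions/maps. Fractional $\mathcal{O}$-ideal: $\mathcal O$-submodule $\mathfrak a\subseteq K$ with $\lambda\mathfrak a\subseteq\mathcal O$ for some $\lambda\in K^\times$; invertible if $\mathfrak a\mathfrak b=\mathcal O$ for some fractional $\mathfrak b$; coprime to integral $\mathfrak c$ if $\mathfrak a=(\mathfrak a_1:\mathfrak b_1)$ with $\mathfrak a_1$ integral and $\mathfrak b_1$ invertible integral, each with sum with $\mathfrak c$ equal to $\mathcal O$. $J^*_{\mathfrak m}(\mathcal O)$: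 group of invertible fractional ideals coprime to $\mathfrak m$. For $\alpha\in K$, $\alpha\equiv1\pmod{\mathfrak m}$ means $\alpha-1\in\mathfrak m\mathcal O[S_{\mathfrak m}^{-1}]$ with $S_{\mathfrak m}=\{a\in\mathcal O:a\mathcal O+\mathfrak m=\mathcal O\}$. $P_{\mathfrak m,\Sigma}(\mathcal O)=\{\alpha\mathcal O:\alpha\in K^\times,\alpha\equiv1\pmod{\mathfrak m},\rho(\alpha)>0\ \forall\rho\in\Sigma\}$; ray class group $\mathrm{Cl}_{\mathfrak m,\Sigma}(\mathcal O)=J^*_{\mathfrak m}(\mathcal O)/P_{\mathfrak m,\Sigma}(\mathcal O)$.
   Formalization: The ideal 𝔡 is assumed nonzero (for 𝔡=0 the sequence fails, e.g. K=ℚ, 𝒪=𝒪'=ℤ, 𝔪=5ℤ, 𝔪'=ℤ, no signs), and S_𝔪 is taken to consist of nonzero elements, which matters only when 𝔪=𝒪. *)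

(* Defs.v *)
From HB Require Import structures.
From mathcomp Require Import all_boot all_order all_algebra all_field.
Set Implicit Arguments. Unset Strict Implicit. Unset Printing Implicit Defensive.
Import Order.TTheory GRing.Theory Num.Theory.
Local Open Scope ring_scope.

(* Subsets of K are Prop-valued predicates (orders and ideals are infinite). *)
Section NumberFieldIdeals.
Variable K : fieldExtType rat.

Definition subset_of (A B : K -> Prop) := forall x, A x -> B x.
Definition seteq (A B : K -> Prop) := forall x, A x <-> B x.

Definition degK : nat := \dim (fullv : {vspace K}).

Definition is_subring (O : K -> Prop) :=
  [/\ O 1, (forall x y, O x -> O y -> O (x - y)) & (forall x y, O x -> O y -> O (x * y))].

Definition is_order (O : K -> Prop) :=
  is_subring O /\
  exists b : 'I_degK -> K,
    (forall x, O x <-> exists z : 'I_degK -> int, x = \sum_i (z i)%:~R * b i) /\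
    (forall z : 'I_degK -> int, \sum_i (z i)%:~R * b i = 0 -> forall i, z i = 0).

Definition is_Omodule (O a : K -> Prop) :=
  [/\ a 0, (forall x y, a x -> a y -> a (x - y)) & (forall r x, O r -> a x -> a (r * x))].

Definition is_integral_ideal (O a : K -> Prop) := is_Omodule O a /\ subset_of a O.

Definition nonzero_set (a : K -> Prop) := exists x, a x /\ x != 0.

Definition is_fractional (O a : K -> Prop) :=
  is_Omodule O a /\ exists l : K, l != 0 /\ forall x, a x -> O (l * x).

Definition iprod (a b : K -> Prop) : K -> Prop := fun x =>
  exists n (u v : 'I_n -> K), (forall i, a (u i) /\ b (v i)) /\ x = \sum_i u i * v i.

Definition isum (a b : K -> Prop) : K -> Prop := fun x =>
  exists u v, [/\ a u, b v & x = u + v].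

Definition colon (a b : K -> Prop) : K -> Prop := fun x => forall y, b y -> a (x * y).

Definition scale (al : K) (b : K -> Prop) : K -> Prop := fun x => exists y, b y /\ x = al * y.

Definition is_invertible (O a : K -> Prop) :=
  is_fractional O a /\ exists b, is_fractional O b /\ seteq (iprod a b) O.

Definition coprime_to (O a c : K -> Prop) :=
  exists a1 b1 : K -> Prop,
    [/\ is_integral_ideal O a1, is_integral_ideal O b1, is_invertible O b1 &
        [/\ seteq (isum a1 c) O, seteq (isum b1 c) O & seteq a (colon a1 b1)]].

Definition Jstar (O m a : K -> Prop) := is_invertible O a /\ coprime_to O a m.

(* S_m = {a in O : aO + m = O} (nonzero elements, so that O[S^-1] ⊆ K) *)
Definition Sm (O m : K -> Prop) : K -> Prop := fun s =>
  [/\ O s, s != 0 & seteq (isum (scale s O) m) O].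

Definition loc (O S : K -> Prop) : K -> Prop := fun x =>
  exists r s, [/\ O r, S s & x = r / s].

Definition congr1 (O m : K -> Prop) (al : K) := iprod m (loc O (Sm O m)) (al - 1).

Definition pos_at (Sig : {rmorphism K -> algC} -> Prop) (al : K) :=
  forall rho, Sig rho -> 0 < rho al.

Definition ray_eqv (O m : K -> Prop) (Sig : {rmorphism K -> algC} -> Prop) (a b : K -> Prop) :=
  exists al : K, [/\ al != 0, congr1 O m al, pos_at Sig al & seteq a (scale al b)].

Definition level_datum (O m : K -> Prop) (Sig : {rmorphism K -> algC} -> Prop) :=
  [/\ is_order O, is_integral_ideal O m, nonzero_set m &
      forall rho, Sig rho -> forall x, rho x \is Num.real].

Definition unit_in (O : K -> Prop) (al : K) := [/\ O al, al != 0 & O al^-1].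
Definition Uunits (O I : K -> Prop) (al : K) := unit_in O al /\ I (al - 1).
Definition USunits (O I : K -> Prop) (Sig : {rmorphism K -> algC} -> Prop) (al : K) :=
  Uunits O I al /\ pos_at Sig al.

(* x in R represents an element of U_I(R/d): a unit mod d, congruent to 1 mod (I + d) *)
Definition res_unit (R d I : K -> Prop) (x : K) :=
  [/\ R x, (exists y, R y /\ d (x * y - 1)) & isum I d (x - 1)].

End NumberFieldIdeals.

(* Groups presented as "setoid groups": carrier predicate, equality relation
   (to encode quotients), multiplication, unit. *)
Record sgroup := SGroup {
  sg_T : Type;
  sg_mem : sg_T -> Prop;
  sg_eqv : sg_T -> sg_T -> Prop;
  sg_mul : sg_T -> sg_T -> sg_T;
  sg_one : sg_T }.

Definition is_hom (G H : sgroup) (f : sg_T G -> sg_T H) :=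
  [/\ (forall x, sg_mem x -> sg_mem (f x)),
      (forall x y, sg_mem x -> sg_mem y -> sg_eqv x y -> sg_eqv (f x) (f y)) &
      (forall x y, sg_mem x -> sg_mem y ->
          sg_eqv (f (sg_mul x y)) (sg_mul (f x) (f y)))].

Definition exact_seq4 (G1 G2 G3 G4 : sgroup)
    (f1 : sg_T G1 -> sg_T G2) (f2 : sg_T G2 -> sg_T G3) (f3 : sg_T G3 -> sg_T G4) :=
  [/\ is_hom f1, is_hom f2, is_hom f3 &
    [/\ (forall x, sg_mem x -> sg_eqv (f1 x) (sg_one G2) -> sg_eqv x (sg_one G1)),
      (forall y, sg_mem y ->
         (sg_eqv (f2 y) (sg_one G3) <-> exists x, sg_mem x /\ sg_eqv (f1 x) y)),
      (forall z, sg_mem z ->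
         (sg_eqv (f3 z) (sg_one G4) <-> exists y, sg_mem y /\ sg_eqv (f2 y) z)) &
      (forall w, sg_mem w -> exists z, sg_mem z /\ sg_eqv (f3 z) w)]].

Section Groups.
Variable K : fieldExtType rat.
Local Notation emb := {rmorphism K -> algC}.

Definition G_units (O m : K -> Prop) (Sig : emb -> Prop)
    (O' m' : K -> Prop) (Sig' : emb -> Prop) : sgroup :=
  @SGroup K (USunits O' m' Sig') (fun x y => USunits O m Sig (x / y)) *%R 1.

(* U_{m'}(O'/d) / U_m(O/d)  x  {±1}^(Sigma \ Sigma'); a sign vector is a
   function emb -> bool (true = -1), only its values on Sigma \ Sigma' matter *)
Definition G_res (O m : K -> Prop) (Sig : emb -> Prop)
    (O' m' : K -> Prop) (Sig' : emb -> Prop) (d : K -> Prop) : sgroup :=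
  @SGroup (K * (emb -> bool)%type)
    (fun p => res_unit O' d m' p.1)
    (fun p q => (exists z, res_unit O d m z /\ d (p.1 - q.1 * z)) /\
                (forall rho, Sig rho -> ~ Sig' rho -> p.2 rho = q.2 rho))
    (fun p q => (p.1 * q.1, fun rho => xorb (p.2 rho) (q.2 rho)))
    (1, fun _ => false).

Definition G_cl (O m : K -> Prop) (Sig : emb -> Prop) : sgroup :=
  @SGroup (K -> Prop) (Jstar O m) (ray_eqv O m Sig) (@iprod K) O.

End Groups.

(* Main.v *)
Require Import Defs.
From HB Require Import structures.
From mathcomp Require Import all_boot all_order all_algebra all_field.
From mathcomp Require Import boolp ring zify.

(* Contraction I |-> I /\ O turns the O'-ideals coprime to d into invertible O-ideals coprime
   to d: it is multiplicative (1 is a sum of an element of I and one of d, and d lies in O),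
   and extension inverts it. The connecting map sends a residue class with signs to the
   contraction of (al), where al in O' lifts the residue and has the given signs on
   Sig \ Sig' and positive ones on Sig'; replacing al by be = al z mod d, with z in O a unit
   mod d and 1 mod m, scales the contraction by be / al.
   Exactness at the class groups needs representatives coprime to d. If i is the inverse of a
   and b in i generates i modulo m i, then b lifts to a generator modulo d i: refine d <= m to
   a chain with simple quotients, which is finite because d contains a positive integer.
   Signs are adjusted inside a coset of d i by a large multiple of an element of prescribed
   signs, obtained from rational approximation at the conjugates of a primitive element. *)

Set Implicit Arguments. Unset Strict Implicit. Unset Printing Implicit Defensive.
Import Order.TTheory GRing.Theory Num.Theory.
Local Open Scope ring_scope.

(* ssrfun also has a [congr1]. *)
Local Notation congr1 := Defs.congr1.

(** * Products, sums, scalings and invertibility of submodules of [K] *)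

Section IdealArithmetic.
Variable K : fieldExtType rat.
Implicit Types (O a b c d m : K -> Prop) (x y z al be : K).

Lemma seteqP a b : seteq a b <-> a = b.
Proof. by split=> [ab|-> x //]; apply/predeqP. Qed.

Lemma subset_anti a b : subset_of a b -> subset_of b a -> a = b.
Proof. by move=> ab ba; apply/predeqP=> x; split; [apply: ab | apply: ba]. Qed.

Lemma subring_module O : is_subring O -> is_Omodule O O.
Proof. by case=> O1 OB OM; split=> //; rewrite -(subrr 1); apply: OB. Qed.

Section Module.
Variables O a : K -> Prop.
Hypothesis Ma : is_Omodule O a.

Lemma omod0 : a 0. Proof. by case: Ma. Qed.
Lemma omodB x y : a x -> a y -> a (x - y). Proof. by case: Ma => _ + _; apply. Qed.
Lemma omodZ x y : O x -> a y -> a (x * y). Proof. by case: Ma => _ _; apply. Qed.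
Lemma omodN x : a x -> a (- x).
Proof. by move=> ax; rewrite -sub0r; apply: omodB ax; apply: omod0. Qed.
Lemma omodD x y : a x -> a y -> a (x + y).
Proof. by move=> ax ay; rewrite -[y]opprK; apply/omodB/omodN. Qed.
Lemma omodZr x y : a x -> O y -> a (x * y).
Proof. by rewrite mulrC => ax Oy; apply: omodZ. Qed.
Lemma omod_sum (I : finType) (F : I -> K) :
  (forall i, a (F i)) -> a (\sum_i F i).
Proof. by move=> aF; elim/big_ind: _ => //; [apply: (omod0) | apply: omodD]. Qed.
Lemma omodMn x n : a x -> a (x *+ n).
Proof. by move=> ax; elim: n => [|n IH]; [apply: (omod0) | rewrite mulrS; apply: omodD]. Qed.

End Module.

Lemma subring1 O : is_subring O -> O 1. Proof. by case. Qed.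

Lemma subring_nat O n : is_subring O -> O n%:R.
Proof. by move=> RO; apply: (omodMn (subring_module RO)); apply: subring1. Qed.

Lemma subring_int O (n : int) : is_subring O -> O n%:~R.
Proof.
move=> RO; case: n => n; first exact: subring_nat.
by rewrite NegzE mulrNz; apply: (omodN (subring_module RO) _); apply: subring_nat.
Qed.

Lemma omod_restrict O O' a :
  subset_of O O' -> is_Omodule O' a -> is_Omodule O a.
Proof. by move=> sO [a0 aB aZ]; split=> // r x /sO; apply: aZ. Qed.

Lemma iprod_mem a b x y : a x -> b y -> iprod a b (x * y).
Proof.
by move=> ax b_y; exists 1, (fun=> x), (fun=> y); split=> //; rewrite big_ord1.
Qed.

Lemma iprod_sub a b c : c 0 -> (forall x y, c x -> c y -> c (x + y)) ->
  (forall x y, a x -> b y -> c (x * y)) -> subset_of (iprod a b) c.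
Proof.
move=> c0 cD cM _ [n [u [v [uv ->]]]].
by elim/big_ind: _ => // i _; case: (uv i); apply: cM.
Qed.

Lemma iprod0 a b : iprod a b 0.
Proof.
by exists 0, (fun=> 0), (fun=> 0); split=> [[]//|]; rewrite big_ord0.
Qed.

Lemma iprodD a b x y : iprod a b x -> iprod a b y -> iprod a b (x + y).
Proof.
move=> [n [u [v [uv ->]]]] [k [u' [v' [uv' ->]]]].
exists (n + k)%N, (fun i => match split i with inl j => u j | inr j => u' j end),
  (fun i => match split i with inl j => v j | inr j => v' j end).
split=> [i|]; first by case: (split i).
rewrite big_split_ord /=; congr (_ + _); apply: eq_bigr => i _.
  by have := unsplitK (inl i : 'I_n + 'I_k); rewrite /unsplit => ->.
by have := unsplitK (inr i : 'I_n + 'I_k); rewrite /unsplit => ->.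
Qed.

Lemma iprod_module O a b : is_Omodule O a -> is_Omodule O (iprod a b).
Proof.
move=> Ma; have Z r x : (forall y, a y -> a (r * y)) -> iprod a b x -> iprod a b (r * x).
  move=> ra; move: x; apply: iprod_sub => [|x y|x y ax b_y].
  - by rewrite mulr0; apply: iprod0.
  - by rewrite mulrDr; apply: iprodD.
  - by rewrite mulrA; apply: iprod_mem => //; apply: ra.
split=> [|x y abx aby|r x Or]; first exact: iprod0.
  apply: iprodD => //; rewrite -mulN1r; apply: Z => // z az.
  by rewrite mulN1r; apply: (omodN Ma az).
by apply: Z => y; apply: (omodZ Ma Or).
Qed.

Lemma iprodC a b : iprod a b = iprod b a.
Proof.
suff S a' b' : subset_of (iprod a' b') (iprod b' a') by apply: subset_anti; apply: S.
apply: iprod_sub; [exact: iprod0 | exact: iprodD |].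
by move=> x y ax b_y; rewrite mulrC; apply: iprod_mem.
Qed.

Lemma iprodA a b c : iprod a (iprod b c) = iprod (iprod a b) c.
Proof.
have S a' b' c' : subset_of (iprod a' (iprod b' c')) (iprod (iprod a' b') c').
  apply: iprod_sub; [exact: iprod0 | exact: iprodD |].
  move=> x y ax; move: y; apply: iprod_sub => [|y z|y z b_y cz].
  - by rewrite mulr0; apply: iprod0.
  - by rewrite mulrDr; apply: iprodD.
  - by rewrite mulrA; do 2!apply: iprod_mem => //.
apply: subset_anti; first exact: S.
by rewrite [iprod (iprod a b) c]iprodC [iprod a b]iprodC [iprod a _]iprodC
  [iprod b c]iprodC; apply: S.
Qed.

Lemma iprodAC a b c : iprod (iprod a b) c = iprod (iprod a c) b.
Proof. by rewrite -!iprodA (iprodC b). Qed.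

Lemma iprodS a b c d :
  subset_of a c -> subset_of b d -> subset_of (iprod a b) (iprod c d).
Proof.
move=> ac bd; apply: iprod_sub; [exact: iprod0 | exact: iprodD |].
by move=> x y ax b_y; apply: iprod_mem; [apply: ac | apply: bd].
Qed.

Lemma iprod_le O a b c : is_Omodule O c ->
  (forall x y, a x -> b y -> c (x * y)) -> subset_of (iprod a b) c.
Proof. by move=> Mc; apply: iprod_sub; [apply: (omod0 Mc) | apply: (omodD Mc)]. Qed.

Lemma iprod_idr O a : O 1 -> is_Omodule O a -> iprod a O = a.
Proof.
move=> O1 Ma; apply: subset_anti => [|x ax].
  by apply: (iprod_le Ma) => x y ax Oy; apply: (omodZr Ma ax Oy).
by rewrite -[x]mulr1; apply: iprod_mem.
Qed.

Lemma iprod_idl O a : O 1 -> is_Omodule O a -> iprod O a = a.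
Proof. by rewrite iprodC; apply: iprod_idr. Qed.

Lemma scale_module O a al : is_Omodule O a -> is_Omodule O (scale al a).
Proof.
move=> Ma; split=> [|_ _ [x [ax ->]] [y [ay ->]]|r _ Or [x [ax ->]]].
- by exists 0; rewrite mulr0; split=> //; apply: (omod0 Ma).
- by exists (x - y); rewrite mulrBr; split=> //; apply: (omodB Ma ax ay).
- by exists (r * x); rewrite mulrCA; split=> //; apply: (omodZ Ma Or ax).
Qed.

Lemma scale_mem a al x : al != 0 -> scale al a x <-> a (x / al).
Proof.
move=> al0; split=> [[y [ay ->]]|ax]; first by rewrite mulrC mulKf.
by exists (x / al); rewrite mulrCA divff ?mulr1.
Qed.

Lemma scaleA al be a : scale al (scale be a) = scale (al * be) a.
Proof.
apply: subset_anti => [_ [_ [[x [ax ->]] ->]]|_ [x [ax ->]]].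
  by exists x; rewrite mulrA.
by exists (be * x); rewrite mulrA; split=> //; exists x.
Qed.

Lemma scale1 a : scale 1 a = a.
Proof.
by apply: subset_anti => [_ [x [ax ->]]|x ax]; [rewrite mul1r | exists x; rewrite mul1r].
Qed.

Lemma scaleK al a : al != 0 -> scale al^-1 (scale al a) = a.
Proof. by move=> al0; rewrite scaleA mulVf ?scale1. Qed.

Lemma iprod_scalel al a b : iprod (scale al a) b = scale al (iprod a b).
Proof.
apply: subset_anti.
  apply: iprod_sub => [|_ _ [x [abx ->]] [y [aby ->]]|_ y [x [ax ->]] b_y].
  - by exists 0; rewrite mulr0; split=> //; apply: iprod0.
  - by exists (x + y); rewrite mulrDr; split=> //; apply: iprodD.
  - by exists (x * y); rewrite mulrA; split=> //; apply: iprod_mem.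
move=> _ [x [abx ->]]; move: x abx; apply: iprod_sub => [|x y|x y ax b_y].
- by rewrite mulr0; apply: iprod0.
- by rewrite mulrDr; apply: iprodD.
- by rewrite mulrA; apply: iprod_mem => //; exists x.
Qed.

Lemma iprod_scaler al a b : iprod a (scale al b) = scale al (iprod a b).
Proof. by rewrite iprodC iprod_scalel iprodC. Qed.

Lemma isum_sub O a b c : is_Omodule O c ->
  subset_of a c -> subset_of b c -> subset_of (isum a b) c.
Proof. by move=> Mc ac bc _ [x [y [/ac cx /bc cy ->]]]; apply: (omodD Mc cx cy). Qed.

Lemma isum_module O a b : is_Omodule O a -> is_Omodule O b -> is_Omodule O (isum a b).
Proof.
move=> Ma Mb; split.
- by exists 0, 0; rewrite addr0; split=> //; [apply: (omod0 Ma) | apply: (omod0 Mb)].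
- move=> _ _ [x [y [ax b_y ->]]] [x' [y' [ax' by' ->]]].
  exists (x - x'), (y - y'); split; last by rewrite opprD addrACA.
    exact: (omodB Ma ax ax').
  exact: (omodB Mb b_y by').
- move=> r _ Or [x [y [ax b_y ->]]]; exists (r * x), (r * y).
  by split; [apply: (omodZ Ma Or ax) | apply: (omodZ Mb Or b_y) | rewrite mulrDr].
Qed.

Lemma isum_full O a b : is_subring O -> is_integral_ideal O a -> is_integral_ideal O b ->
  seteq (isum a b) O <-> exists x, a x /\ b (1 - x).
Proof.
move=> RO [Ma aO] [Mb bO]; split=> [ab|[x [ax bx]] y].
  have /ab[x [y [ax b_y e]]] := subring1 RO.
  by exists x; rewrite e addrAC subrr add0r.
split=> [|Oy]; first exact: (isum_sub (subring_module RO) aO bO).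
exists (y * x), (y * (1 - x)).
by split; [apply: (omodZ Ma Oy ax) | apply: (omodZ Mb Oy bx) | ring].
Qed.

(* The element is nonzero even in the degenerate case [b = O]. *)
Lemma coprime_elt O a b : is_integral_ideal O a -> is_integral_ideal O b ->
  nonzero_set a -> nonzero_set b -> isum a b 1 ->
  exists x, [/\ a x, x != 0 & b (1 - x)].
Proof.
move=> [Ma aO] [Mb bO] [u [au u0]] [v [bv v0]] [x [y [ax b_y e]]].
have [x0|x0] := eqVneq x 0; last first.
  by exists x; rewrite e addrAC subrr add0r.
exists (u * v); split; [|by rewrite mulf_neq0|].
  exact: (omodZr Ma au (bO _ bv)).
have -> : 1 - u * v = y - u * v by rewrite e x0 add0r.
apply: (omodB Mb b_y _).
exact: (omodZ Mb (aO _ au) bv).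
Qed.

Lemma integral_fractional O a : is_integral_ideal O a -> is_fractional O a.
Proof.
by move=> [Ma aO]; split=> //; exists 1; split=> [|x /aO]; rewrite ?oner_neq0 ?mul1r.
Qed.

Lemma order_ideal O : is_subring O -> is_integral_ideal O O.
Proof. by move=> /subring_module; split. Qed.

Lemma order_invertible O : is_subring O -> is_invertible O O.
Proof.
move=> RO; have FO := integral_fractional (order_ideal RO).
split=> //; exists O; split=> //; apply/seteqP.
by apply: iprod_idr; [apply: subring1 | apply: subring_module].
Qed.

Lemma invertible_nonzero O a b : O 1 -> seteq (iprod a b) O -> nonzero_set a.
Proof.
move=> O1 /(_ 1)[_ /(_ O1)[n [u [v [uv e]]]]].
case: (pickP (fun i => u i != 0)) => [i ui|u0]; first by exists (u i); case: (uv i).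
have := oner_neq0 K; rewrite e big1 ?eqxx // => i _.
by move/negbFE: (u0 i) => /eqP->; rewrite mul0r.
Qed.

Lemma fractional_scale O a al :
  al != 0 -> is_fractional O a -> is_fractional O (scale al a).
Proof.
move=> al0 [Ma [l [l0 la]]]; split; first exact: scale_module.
exists (l / al); split; first by rewrite mulf_neq0 ?invr_eq0.
by move=> _ [x [ax ->]]; rewrite mulrA divfK //; apply: la.
Qed.

Lemma invertible_scale O a al :
  al != 0 -> is_invertible O a -> is_invertible O (scale al a).
Proof.
move=> al0 [Fa [a' [Fa' /seteqP aa']]]; split; first exact: fractional_scale.
exists (scale al^-1 a'); split; first by apply: fractional_scale => //; rewrite invr_eq0.
by apply/seteqP; rewrite iprod_scaler iprod_scalel scaleK.
Qed.

(* Integral ideals are coprime to [m] in the sense of [coprime_to]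
   through the presentation [a = (a : O)]. *)
Lemma Jstar_integral O m a : is_subring O -> is_integral_ideal O m ->
  is_integral_ideal O a -> is_invertible O a -> isum a m 1 -> Jstar O m a.
Proof.
move=> RO Im Ia Ja [x [y [ax my e]]]; split=> //; exists a, O; split=> //.
- exact: order_ideal.
- exact: order_invertible.
split.
- by apply/isum_full => //; exists x; rewrite e addrAC subrr add0r.
- apply/isum_full=> //; first exact: order_ideal.
  by exists 1; rewrite subrr; split; [apply: subring1 | apply: (omod0 Im.1)].
- case: Ia => Ma _ z; split=> [az u Ou|/(_ 1)]; first exact: (omodZr Ma az Ou).
  by rewrite mulr1; apply; apply: subring1.
Qed.

(** * Multiplicative congruence to 1 modulo [m] *)

Section Congruences.
Variables O m : K -> Prop.
Hypotheses (RO : is_subring O) (Im : is_integral_ideal O m).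

Lemma SmP s : Sm O m s <-> [/\ O s, s != 0 & exists2 w, O w & m (1 - s * w)].
Proof.
have MO := subring_module RO.
split=> [[Os s0 /(_ 1)[_ /(_ (subring1 RO))]]|[Os s0 [w Ow mw]]].
  move=> [_ [y [[w [Ow ->]] my e]]]; split=> //; exists w => //.
  by rewrite e addrAC subrr add0r.
split=> //; apply/isum_full => //; last by exists (s * w); split=> //; exists w.
split; first exact: scale_module.
by move=> _ [x [Ox ->]]; apply: (omodZ MO Os Ox).
Qed.

Lemma Sm1 : Sm O m 1.
Proof.
apply/SmP; split; [exact: subring1 | exact: oner_neq0|].
by exists 1; [exact: subring1|rewrite mulr1 subrr; apply: (omod0 Im.1)].
Qed.

Lemma SmM s t : Sm O m s -> Sm O m t -> Sm O m (s * t).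
Proof.
have MO := subring_module RO; case: Im => Mm mO.
move=> /SmP[Os s0 [w Ow mw]] /SmP[Ot t0 [v Ov mv]]; apply/SmP; split.
- exact: (omodZ MO Os Ot).
- by rewrite mulf_neq0.
exists (w * v); first exact: (omodZ MO Ow Ov).
have -> : 1 - s * t * (w * v) = (1 - s * w) + s * w * (1 - t * v) by ring.
by apply: (omodD Mm mw _); apply: (omodZ Mm _ mv); apply: (omodZ MO Os Ow).
Qed.

Lemma Sm_near1 s : O s -> s != 0 -> m (1 - s) -> Sm O m s.
Proof.
by move=> Os s0 ms; apply/SmP; split=> //; exists 1; rewrite ?mulr1 //; apply: subring1.
Qed.

(** Terms [x * (r / s)] are brought to a common denominator: [Sm] is closed under products, so a
    single [s] clears a whole finite sum. *)
Lemma congr1P al : congr1 O m al <-> exists2 s, Sm O m s & m (s * (al - 1)).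
Proof.
rewrite /congr1; case: (Im) => Mm mO; split; last first.
  move=> [s Ss ms]; have /SmP[_ s0 _] := Ss.
  rewrite -[al - 1](mulKf s0) mulrC; apply: iprod_mem => //.
  by exists 1, s; rewrite mul1r; split=> //; apply: subring1.
move: (al - 1); apply: iprod_sub.
- by exists 1; [apply: Sm1 | rewrite mulr0; apply: (omod0 Mm)].
- move=> x y [s Ss msx] [t St mty]; exists (s * t); first exact: SmM.
  have -> : s * t * (x + y) = t * (s * x) + s * (t * y) by ring.
  have /SmP[Os _ _] := Ss; have /SmP[Ot _ _] := St.
  by apply: (omodD Mm (omodZ Mm Ot msx) (omodZ Mm Os mty)).
- move=> x _ mx [r [s [Or Ss ->]]]; exists s => //; have /SmP[_ s0 _] := Ss.
  have -> : s * (x * (r / s)) = r * x * (s / s) by ring.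
  by rewrite divff // mulr1; apply: (omodZ Mm Or mx).
Qed.

(** A denominator [s] is invertible modulo [m], with inverse [w], so [s * (al - 1)] in [m] forces
    [al - 1] into [m]. *)
Lemma congr1_integral al : O al -> congr1 O m al -> m (al - 1).
Proof.
move=> Oal /congr1P[s /SmP[Os s0 [w Ow mw]] ms]; case: Im => Mm mO.
have -> : al - 1 = w * (s * (al - 1)) + (al - 1) * (1 - s * w) by ring.
apply: (omodD Mm (omodZ Mm Ow ms) _); apply: (omodZ Mm _ mw).
by apply: (omodB (subring_module RO) Oal _); apply: subring1.
Qed.

Lemma congr1_1 : congr1 O m 1.
Proof. by rewrite /congr1 subrr; apply: iprod0. Qed.

Lemma congr1M al be : congr1 O m al -> congr1 O m be -> congr1 O m (al * be).
Proof.
have MO := subring_module RO; case: (Im) => Mm mO.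
move=> /congr1P[s Ss ms] /congr1P[t St mt]; apply/congr1P.
exists (s * t); first exact: SmM.
have -> : s * t * (al * be - 1) = (s * (al - 1)) * (t * (be - 1))
  + s * (t * (be - 1)) + t * (s * (al - 1)) by ring.
have /SmP[Os _ _] := Ss; have /SmP[Ot _ _] := St.
apply: (omodD Mm _ (omodZ Mm Ot ms)); apply: (omodD Mm _ (omodZ Mm Os mt)).
by apply: (omodZ Mm _ mt); apply: mO.
Qed.

(** Since [s * al] and [s] agree modulo [m], the product [s * al] is again a denominator, with the
    same inverse [w], and it serves for [al^-1]. *)
Lemma congr1V al : al != 0 -> congr1 O m al -> congr1 O m al^-1.
Proof.
have MO := subring_module RO; case: (Im) => Mm mO.
move=> al0 /congr1P[s /SmP[Os s0 [w Ow mw]] ms]; apply/congr1P.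
have Osal : O (s * al).
  have -> : s * al = s * (al - 1) + s by ring.
  by apply: (omodD MO (mO _ ms) Os).
exists (s * al).
  apply/SmP; split; rewrite ?mulf_neq0 //; exists w => //.
  have -> : 1 - s * al * w = (1 - s * w) - w * (s * (al - 1)) by ring.
  by apply: (omodB Mm mw _); apply: (omodZ Mm Ow ms).
have -> : s * al * (al^-1 - 1) = s * (al / al) - s * al by ring.
rewrite divff // mulr1 -[s - _]opprB; apply: (omodN Mm _).
by have <- : s * (al - 1) = s * al - s by ring.
Qed.

End Congruences.

Lemma congr1_mono O m O' m' al :
  is_subring O -> is_integral_ideal O m -> is_subring O' -> is_integral_ideal O' m' ->
  subset_of O O' -> subset_of m m' -> congr1 O m al -> congr1 O' m' al.
Proof.
move=> RO Im RO' Im' sO sm /congr1P-/(_ RO Im)[s /SmP-/(_ RO Im)[Os s0 [w Ow mw]] ms].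
apply/congr1P=> //; exists s; last exact: sm.
by apply/SmP => //; split=> //; [apply: sO | exists w; [apply: sO | apply: sm]].
Qed.

End IdealArithmetic.

(** * Orders as lattices: denominators and finite residue rings *)

Lemma rat_common_denominator n (k : 'I_n -> rat) :
  exists D : nat, (0 < D)%N /\ exists z : 'I_n -> int, forall i, k i * D%:R = (z i)%:~R.
Proof.
exists (\prod_i `|denq (k i)|)%N; split.
  by apply: prodn_gt0 => i; rewrite absz_gt0 denq_neq0.
exists (fun i => numq (k i) * (\prod_(j | j != i) `|denq (k j)|)%N%:Z) => i.
rewrite (bigD1 i) //= natrM intrM mulrA -pmulrn; congr (_ * _).
by rewrite numqE pmulrn absz_denq.
Qed.

Section Order.
Variables (K : fieldExtType rat) (O : K -> Prop).
Hypothesis OO : is_order O.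

Lemma order_subring : is_subring O. Proof. by case: OO. Qed.

(** A Z-basis of [O] is a Q-basis of [K]: clearing denominators turns a rational relation into an
    integral one, and the number of elements is the degree. The coordinates of [x] then have a
    common denominator. *)
Lemma order_denominator x : exists D : nat, (0 < D)%N /\ O (D%:R * x).
Proof.
have [_ [b [bO bfree]]] := OO.
pose X := [tuple b i | i < degK K].
have XE (k : 'I_(degK K) -> rat) : \sum_i k i *: X`_i = \sum_i k i *: b i.
  by apply: eq_bigr => i _; rewrite -tnth_nth tnth_mktuple.
have clear (k : 'I_(degK K) -> rat) : exists D : nat, (0 < D)%N /\
    exists z : 'I_(degK K) -> int, (forall i, k i * D%:R = (z i)%:~R) /\
      D%:R * \sum_i k i *: X`_i = \sum_i (z i)%:~R * b i.
  have [D [D0 [z zE]]] := rat_common_denominator k; exists D; split=> //; exists z; split=> //.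
  rewrite XE mulr_sumr; apply: eq_bigr => i _.
  rewrite mulr_natl -scaler_nat scalerA mulrC zE.
  by rewrite scaler_int mulrzl.
have fX : free X.
  apply/freeP => k k0 i; have [D [D0 [z [zE e]]]] := clear k.
  have := bfree z; rewrite -e k0 mulr0 => /(_ erefl i) z0.
  have /eqP := zE i; rewrite z0 mulr0z mulf_eq0 pnatr_eq0 -(negbK (D == 0)%N) -lt0n D0 orbF.
  by move/eqP.
have bX : basis_of fullv X by rewrite basisEfree fX subvf size_tuple /=.
have [D [D0 [z [_ e]]]] := clear (fun i => coord X i x).
exists D; split=> //; rewrite (coord_basis bX (memvf x)) e.
by apply/bO; exists z.
Qed.

Lemma nonzero_ideal_nat d :
  is_integral_ideal O d -> nonzero_set d -> exists N : nat, (0 < N)%N /\ d N%:R.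
Proof.
move=> [Md dO] [x [dx x0]]; have [D [D0 OD]] := order_denominator x^-1.
exists D; split=> //; have -> : D%:R = D%:R * x^-1 * x by rewrite divfK.
exact: (omodZ Md OD dx).
Qed.

(* [O / d] is finite; the size of [a] counts the classes that it contains. *)
Lemma ideal_size d : is_integral_ideal O d -> nonzero_set d ->
  exists sz : (K -> Prop) -> nat, forall a b, is_integral_ideal O b -> is_Omodule O a ->
    subset_of d a -> subset_of a b -> ~ subset_of b a -> (sz a < sz b)%N.
Proof.
move=> Id nzd; have [N [N0 dN]] := nonzero_ideal_nat Id nzd.
have [_ [b [bO _]]] := OO; have RO := order_subring; have MO := subring_module RO.
(* Every class of [O / d] contains a combination of the basis with coefficients below [N], because
   [N] lies in [d]. *)
pose rep (f : {ffun 'I_(degK K) -> 'I_N}) : K := \sum_i (f i)%:R * b i.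
have repP x : O x -> exists f, d (x - rep f).
  move=> /bO[z ->].
  have zN i : (`|(z i %% N)%Z| < N)%N.
    have := ltz_pmod (z i) (N0 : (0 < N%:Z)%R).
    by rewrite -[(_ %% _)%Z]gez0_abs ?ltz_nat // modz_ge0 // -lt0n.
  exists [ffun i => Ordinal (zN i)]; rewrite /rep -sumrB.
  have bO' i : O (b i).
    apply/bO; exists (fun j => (i == j)%:Z); rewrite (bigD1 i) //= eqxx mul1r big1 ?addr0 //.
    by move=> j /negPf ji; rewrite eq_sym ji mul0r.
  apply: (omod_sum Id.1) => i; rewrite ffunE /=.
  have -> : (z i)%:~R * b i - `|(z i %% N)%Z|%:R * b i = (z i %/ N)%Z%:~R * b i * N%:R.
    rewrite pmulrn gez0_abs ?modz_ge0 // -?lt0n // {1}(divz_eq (z i) N) rmorphD rmorphM /=.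
    by rewrite -pmulrn; ring.
  apply: (omodZ Id.1 _ dN); apply: (omodZ MO _ (bO' i)); exact: subring_int.
exists (fun a => #|[pred f | `[< a (rep f) >]]|) => a c [Mc cO] Ma da ac nca.
apply: proper_card; apply/properP; split.
  by apply/subsetP => f /asboolP af; apply/asboolP/ac.
have [x [cx nax]] : exists x, c x /\ ~ a x.
  by apply: contrapT => h; apply: nca => x cx; apply: contrapT => nax; apply: h; exists x.
have [f df] := repP x (cO x cx); exists f; rewrite !inE.
  apply/asboolP; have -> : rep f = x - (x - rep f) by ring.
  by apply: (omodB Mc cx); apply/ac/da.
apply/asboolP => af; apply: nax; have -> : x = rep f + (x - rep f) by ring.
by apply: (omodD Ma af); apply: da.
Qed.

End Order.

(** * Rational polynomials with prescribed signs at real points *)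

Section RealPoints.
Local Notation evalr p r := (map_poly (ratr : rat -> algC) p).[r].

(** Archimedean argument: once [n * (y - x)] exceeds 1, the first integer above [n * x] stays below
    [n * y]. *)
Lemma rat_dense (x y : algC) : x \is Num.real -> y \is Num.real -> x < y ->
  exists q : rat, x < ratr q < y.
Proof.
move=> Rx Ry xy; have yx0 : 0 < y - x by rewrite subr_gt0.
set n := (Num.truncn (y - x)^-1).+1.
have n0 : (0 : algC) < n%:R by rewrite ltr0n.
have nxy : 1 < n%:R * (y - x).
  rewrite -ltr_pdivrMr // div1r; apply: real_truncnS_gt.
  by rewrite ger0_real // invr_ge0 ltW.
have Rnx : n%:R * x \is Num.real by rewrite realM // realn.
have /andP[f1 f2] := real_floor_itv Rnx.
exists ((Num.floor (n%:R * x) + 1)%:~R / n%:R).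
rewrite fmorph_div /= ratr_int ratr_nat ltr_pdivlMr // (mulrC x) f2 /=.
rewrite ltr_pdivrMr // (mulrC y) intrD; apply: le_lt_trans (_ : n%:R * x + 1 < _).
  by rewrite lerD2r.
by move: nxy; rewrite mulrBr ltrBrDl.
Qed.

Lemma real_gap (rs : seq algC) (r : algC) : exists2 e : algC, 0 < e &
  forall r', r' \in rs -> r' != r -> e <= `|r' - r|.
Proof.
elim: rs => [|r1 rs [e e0 he]]; first by exists 1.
have [-> |r1r] := eqVneq r1 r.
  by exists e => // r'; rewrite inE => /orP[/eqP->|/he//]; rewrite eqxx.
have d0 : 0 < `|r1 - r| by rewrite normr_gt0 subr_eq0.
have le_e := real_leP (gtr0_real e0) (gtr0_real d0).
have [le1|lt1] := le_e.
  by exists e => // r'; rewrite inE => /orP[/eqP->|/he].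
exists `|r1 - r| => // r'; rewrite inE => /orP[/eqP->//|/he/[apply]].
exact/le_trans/ltW.
Qed.

(* The quadratic [(X - a)(X - b)] with rational [a < r < b] close to [r]. *)
Lemma isolating_poly (rs : seq algC) (r : algC) :
  r \is Num.real -> all (fun x => x \is Num.real) rs -> exists p : {poly rat},
    evalr p r < 0 /\ forall r', r' \in rs -> r' != r -> 0 < evalr p r'.
Proof.
move=> Rr /allP Rrs; have [e e0 he] := real_gap rs r.
have Re := gtr0_real e0.
have [a /andP[a1 a2]] : exists a : rat, r - e < ratr a < r.
  by apply: rat_dense; rewrite ?realB // ltrBlDr ltrDl.
have [b /andP[b1 b2]] : exists b : rat, r < ratr b < r + e.
  by apply: rat_dense; rewrite ?realD // ltrDl.
exists (('X - a%:P) * ('X - b%:P)).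
have E r' : evalr (('X - a%:P) * ('X - b%:P)) r' = (r' - ratr a) * (r' - ratr b).
  by rewrite rmorphM /= !map_polyXsubC hornerM !hornerXsubC.
rewrite E; split; first by rewrite pmulr_rlt0 ?subr_lt0 ?subr_gt0.
move=> r' r'rs r'r; have := he _ r'rs r'r; rewrite E; have Rr' := Rrs _ r'rs.
rewrite real_ler_normr ?realB //; case/orP => h.
  have hb : ratr b < r' by apply: lt_le_trans b2 _; rewrite addrC -lerBrDr.
  by rewrite mulr_gt0 // subr_gt0 // (lt_trans _ hb) // (lt_trans a2).
have ha : r' < ratr a by apply: le_lt_trans a1; rewrite lerBrDr addrC -lerBrDr -opprB; exact: h.
by rewrite nmulr_rgt0 subr_lt0 // (lt_trans ha) // (lt_trans a2).
Qed.

(** Take a product of isolating quadratics, one for each point of [l]. Each factor is negative at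
    its own point and positive at the other points of [rs]; as [l] has no repetition, exactly one
    factor is negative at a point of [l]. *)
Lemma sign_poly (rs l : seq algC) : all (fun x => x \is Num.real) rs ->
  uniq l -> {subset l <= rs} ->
  exists p : {poly rat}, forall r, r \in rs ->
    if r \in l then evalr p r < 0 else 0 < evalr p r.
Proof.
move=> Rrs; elim: l => [_ _|r l IH /andP[rl ul] sl].
  by exists 1 => r _; rewrite rmorph1 hornerC ltr01.
have [p hp] := IH ul (fun x xl => sl x (mem_behead (s := r :: l) xl)).
have rrs : r \in rs by rewrite sl ?mem_head.
have [q [qr hq]] := isolating_poly (allP Rrs _ rrs) Rrs.
exists (p * q) => r' r'rs; rewrite rmorphM hornerM inE.
have := hp _ r'rs; have [->|r'r] := eqVneq r' r.
  by rewrite (negPf rl) /= => pr; rewrite pmulr_rlt0.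
by case: ifP => _ pr /=; rewrite ?pmulr_rgt0 ?pmulr_llt0 ?hq.
Qed.

End RealPoints.

(** * Embeddings and a primitive element *)

Section Embeddings.
Variable K : fieldExtType rat.
Local Notation emb := {rmorphism K -> algC}.

(** The structure proofs agree by irrelevance. This lets an embedding be recovered from the image of
    a primitive element. *)
Lemma emb_eq (rho sig : emb) : rho =1 sig -> rho = sig.
Proof.
case: rho sig => [f [[af] [mf]]] [g [[ag] [mg]]] /= /funext fg.
by subst g; rewrite (Prop_irrelevance af ag) (Prop_irrelevance mf mg).
Qed.

(** Characteristic 0 makes [K] separable over Q, hence generated by one [th]. Embeddings fix
    rational coefficients, so the same [p] serves every [rho]. *)
Lemma primitive_element : exists th : K, forall x : K,
  exists p : {poly rat}, forall rho : emb, rho x = (map_poly ratr p).[rho th].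
Proof.
have sep : separable (1%VS : {vspace K}) fullv.
  apply/separableP => x _; apply: pcharf0_separable.
  move=> p; rewrite !inE; apply/negP => /andP[pp].
  by rewrite -(rmorph_nat (in_alg K)) fmorph_eq0 pnatr_eq0; case: p pp.
have := eq_adjoin_separable_generator (E := {:K}%AS) (K := 1%AS) sep (subvf _).
move: (separable_generator _ _) => th Kth; exists th => x.
have : x \in <<1; th>>%VS by rewrite -Kth memvf.
case/Fadjoin_polyP => _ /polyOver1P[p ->] ->; exists p => rho.
rewrite -horner_map -map_poly_comp; congr (_.[_]); apply: eq_map_poly => q /=.
exact: (fmorph_eq_rat (rho \o in_alg K)).
Qed.

End Embeddings.

(** * Elements with prescribed signs in a given coset *)

Section Signs.
Variable K : fieldExtType rat.
Local Notation emb := {rmorphism K -> algC}.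
Implicit Types (rho : emb) (Sig : emb -> Prop) (s : emb -> bool).

Definition real_at Sig := forall rho, Sig rho -> forall x, rho x \is Num.real.

Lemma sign_pos Sig rho al : real_at Sig -> Sig rho -> al != 0 ->
  (0 < rho al) = ~~ (rho al < 0).
Proof.
by move=> RS Sr al0; rewrite -real_leNgt ?real0 ?RS // le0r fmorph_eq0 (negPf al0).
Qed.

Lemma sign_mul Sig rho al be : real_at Sig -> Sig rho -> al != 0 -> be != 0 ->
  (rho (al * be) < 0) = xorb (rho al < 0) (rho be < 0).
Proof.
move=> RS Sr al0 be0; rewrite rmorphM.
have := sign_pos RS Sr al0; have := sign_pos RS Sr be0.
case: (boolP (rho be < 0)) => b0 /= b1; case: (boolP (rho al < 0)) => a0 /= a1.
- by apply/negP; rewrite nmulr_rlt0 // b1.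
- by rewrite pmulr_rlt0 // a1.
- by rewrite nmulr_rlt0 // b1.
- by apply/negbTE; rewrite pmulr_rlt0 ?a1 // b0.
Qed.

(** The images of [th] are roots of its minimal polynomial. *)
Lemma emb_finite (th : K) : (forall x : K,
    exists p : {poly rat}, forall rho, rho x = (map_poly ratr p).[rho th]) ->
  exists rs : seq algC, forall rho, rho th \in rs.
Proof.
move=> thP; have [q q0 rq] : exists2 q : {poly rat}, q != 0 &
    forall rho, root (map_poly ratr q) (rho th).
  have /polyOver1P[q Eq] := minPolyOver 1%AS th.
  exists q => [|rho].
    by have := monic_neq0 (monic_minPoly 1%AS th); rewrite Eq map_poly_eq0.
  have := root_minPoly 1%AS th; rewrite Eq => /(rmorph_root rho).
  rewrite -map_poly_comp; congr (root _ _); apply: eq_map_poly => c /=.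
  exact: (fmorph_eq_rat (rho \o in_alg K)).
have [rs Ers] := closed_field_poly_normal (map_poly (ratr : rat -> algC) q).
exists rs => rho; have := rq rho; rewrite Ers rootZ ?root_prod_XsubC //.
by rewrite lead_coef_eq0 map_poly_eq0.
Qed.

(** As [rho th] determines [rho], signs may be prescribed at the real conjugates of [th]; a rational
    polynomial with these signs is evaluated at [th]. *)
Lemma sign_elt Sig s : real_at Sig ->
  exists2 k : K, k != 0 & forall rho, Sig rho -> (rho k < 0) = s rho.
Proof.
move=> RS; have [th thP] := primitive_element K.
have [rs0 rs0P] := emb_finite thP.
pose rs := [seq r <- rs0 | r \is Num.real].
(* [l] collects the conjugates at which the value must be negative. *)
pose l := undup [seq r <- rs | `[< exists rho, [/\ Sig rho, rho th = r & s rho] >]].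
have [||//|p hp] := @sign_poly rs l.
- by apply/allP => r; rewrite mem_filter => /andP[].
- exact: undup_uniq.
- by move=> r; rewrite mem_undup mem_filter => /andP[].
pose k : K := (map_poly (in_alg K) p).[th].
have kE rho : rho k = (map_poly ratr p).[rho th].
  rewrite -horner_map -map_poly_comp; congr (_.[_]); apply: eq_map_poly => q /=.
  exact: (fmorph_eq_rat (rho \o in_alg K)).
have hk rho : Sig rho -> if s rho then rho k < 0 else 0 < rho k.
  move=> Sr; have rrs : rho th \in rs by rewrite mem_filter rs0P (RS _ Sr).
  have := hp _ rrs; rewrite mem_undup mem_filter rrs andbT -kE.
  suff -> : `[< exists rho', [/\ Sig rho', rho' th = rho th & s rho'] >] = s rho by [].
  apply/asboolP/idP => [[rho' [_ e s']]|sr]; last by exists rho.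
  suff -> : rho = rho' by [].
  by apply: emb_eq => x; have [px hx] := thP x; rewrite !hx e.
have sk rho : Sig rho -> k != 0 /\ (rho k < 0) = s rho.
  move=> Sr; have := hk _ Sr; rewrite -(fmorph_eq0 rho).
  by case: (s rho) => h; split; rewrite ?(lt_eqF h) ?(gt_eqF h) ?(lt_gtF h).
(* [k] can vanish only when [Sig] is empty, and then 1 will do. *)
have [k0|k0] := eqVneq k 0; last by exists k => // rho /sk[].
by exists 1 => [|rho /sk[]]; rewrite ?oner_neq0 // k0 eqxx.
Qed.

(** [x / k] is a rational polynomial in [th], and its values at the finitely many conjugates of [th]
    have a common bound. *)
Lemma emb_bound Sig x k : k != 0 ->
  exists M : nat, forall rho, Sig rho -> `|rho x| < M%:R * `|rho k|.
Proof.
move=> k0; have [th thP] := primitive_element K.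
have [rs rsP] := emb_finite thP; have [p hp] := thP (x / k).
have [M hM] : exists M : nat, forall r, r \in rs -> `|(map_poly (ratr : rat -> algC) p).[r]| < M%:R.
  elim: rs {rsP} => [|r rs [M hM]]; first by exists 0.
  set v := `|(map_poly ratr p).[r]|; exists (maxn M (Num.truncn v).+1) => r'.
  rewrite inE => /orP[/eqP->|/hM h].
    apply: lt_le_trans (_ : (Num.truncn v).+1%:R <= _); last by rewrite ler_nat leq_maxr.
    by apply: real_truncnS_gt; apply: normr_real.
  by apply: lt_le_trans h _; rewrite ler_nat leq_maxl.
exists M => rho _; rewrite -ltr_pdivrMr ?normr_gt0 ?fmorph_eq0 //.
by rewrite -normf_div -fmorph_div hp; apply: hM.
Qed.

(** A large multiple of an element of [L] with the prescribed signs is added to [x]; it dominates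
    [x] at every embedding in [Sig]. *)
Lemma sign_approx (O L : K -> Prop) Sig s x :
  is_order O -> is_Omodule O L -> nonzero_set L -> real_at Sig ->
  exists al, [/\ al != 0, L (al - x) & forall rho, Sig rho -> (rho al < 0) = s rho].
Proof.
move=> OO ML [y [Ly y0]] RS; have [k k0 ks] := sign_elt s RS.
have [D [D0 OD]] := order_denominator OO (k / y).
have Dk0 : D%:R != 0 :> K.
  by rewrite -(rmorph_nat (in_alg K)) fmorph_eq0 pnatr_eq0 -lt0n.
pose k' := D%:R * k.
have k'0 : k' != 0 by rewrite mulf_neq0.
have Lk' : L k'.
  have -> : k' = D%:R * (k / y) * y by rewrite -mulrA divfK.
  exact: (omodZ ML OD Ly).
have D0' : (0 : algC) < D%:R by rewrite ltr0n.
have k's rho : Sig rho -> (rho k' < 0) = s rho.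
  by move=> Sr; rewrite rmorphM rmorph_nat pmulr_rlt0 // ks.
(* The split keeps [al] nonzero: in the trivial coset [k'] itself serves, and a nontrivial coset
   does not contain 0. *)
have [Lx|nLx] := EM (L x).
  by exists k'; split=> //; apply: (omodB ML).
have [M hM] := emb_bound Sig x k'0.
have LM : L (k' *+ M) by apply: (omodMn ML).
exists (x + k' *+ M); split.
- apply/eqP => e; apply: nLx; have -> : x = - (k' *+ M) by apply/eqP; rewrite -addr_eq0 e.
  exact: (omodN ML).
- by rewrite addrAC subrr add0r.
move=> rho Sr; rewrite rmorphD rmorphMn -k's //.
have := hM _ Sr; have Rx := RS _ Sr x; have Rk := RS _ Sr k'.
rewrite -(mulr_natl (rho k')); have [k's0|k's0] := boolP (rho k' < 0).
  rewrite (ltr0_norm k's0) mulrN real_ltr_norml ?realN ?realM ?realn //.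
  by move=> /andP[_ h]; rewrite -ltrBrDr sub0r.
have k'p : 0 < rho k' by rewrite (sign_pos RS Sr).
rewrite (gtr0_norm k'p) real_ltr_norml ?realM ?realn // => /andP[h _].
by apply/negbTE; rewrite lt_gtF // -ltrBlDr sub0r.
Qed.

End Signs.

(** * Representatives of ray classes that are coprime to [d] *)

Section Moving.
Variables (K : fieldExtType rat) (O : K -> Prop).
Hypothesis OO : is_order O.
Let RO : is_subring O := order_subring OO.
Let MO : is_Omodule O O := subring_module RO.

Lemma cap_module a b :
  is_Omodule O a -> is_Omodule O b -> is_Omodule O (fun x : K => a x /\ b x).
Proof.
move=> Ma Mb; split=> [|x y [ax bx] [ay b_y]|r x Or [ax bx]].
- by split; [apply: (omod0 Ma) | apply: (omod0 Mb)].
- by split; [apply: (omodB Ma) | apply: (omodB Mb)].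
- by split; [apply: (omodZ Ma) | apply: (omodZ Mb)].
Qed.

(* The lift of a generator when [m / d] is simple: writing [1 = u + mu] along
   [O / d = (b a + d) / d + m / d], a generator is [b + mu w] for any [w] that
   is not killed by [mu]. *)
Lemma lift_generator_simple a i d m b :
  is_Omodule O a -> is_Omodule O i -> seteq (iprod a i) O ->
  is_integral_ideal O d -> is_integral_ideal O m -> subset_of d m ->
  (forall e, is_Omodule O e -> subset_of d e -> subset_of e m ->
     subset_of e d \/ subset_of m e) ->
  i b -> isum (scale b a) m 1 ->
  exists v, [/\ i v, iprod m i (v - b) & isum (scale v a) d 1].
Proof.
move=> Ma Mi /seteqP ai [Md dO] [Mm mO] dm simple ib bm.
have aiO x y : a x -> i y -> O (x * y) by move=> ax iy; rewrite -ai; apply: iprod_mem.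
pose I := isum (scale b a) d.
have MI : is_Omodule O I by apply: isum_module => //; apply: scale_module.
have dI : subset_of d I.
  by move=> x dx; exists 0, x; rewrite add0r; split=> //; apply: (omod0 (scale_module b Ma)).
have baI y : a y -> I (b * y).
  by move=> ay; exists (b * y), 0; rewrite addr0; split=> //; [exists y | apply: (omod0 Md)].
have [I1|nI1] := EM (I 1).
  by exists b; split=> //; rewrite subrr; apply: iprod0.
(* By simplicity the intersection of [I] and [m] lies in [d] or is all of [m]; in the latter case
   [I] would contain [mu], hence 1. *)
have Imd x : I x -> m x -> d x.
  move=> Ix mx; have [||h|h] := simple _ (cap_module MI Mm).
  - by move=> y dy; split; [apply: dI | apply: dm].
  - by move=> y [].
  - exact: h.
  - case: nI1; have [_ [mu [[y [ay ->]] mmu ->]]] := bm.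
    by apply: (omodD MI); [apply: baI | have [] := h mu mmu].
have [_ [mu [[y [ay ->]] mmu e1]]] := bm; set u := b * y in e1.
have Iu : I u := baI y ay.
have Ou : O u by rewrite /u mulrC; apply: aiO.
(* If [mu] killed every product [a0 * w] modulo [d], it would kill [a i = O], so [mu] would lie in
   [d] and 1 in [I]. *)
have [w [a0 [iw aa0 nd]]] : exists w a0, [/\ i w, a a0 & ~ d (mu * (a0 * w))].
  apply: contrapT => h; apply: nI1; rewrite e1; apply: (omodD MI) => //; apply: dI.
  have : iprod a i 1 by rewrite ai; apply: subring1.
  suff S : subset_of (iprod a i) (fun t => d (mu * t)) by move=> /S; rewrite mulr1.
  apply: iprod_sub => [|x z dx dz|x z ax iz].
  - by rewrite mulr0; apply: (omod0 Md).
  - by rewrite mulrDr; apply: (omodD Md).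
  - by apply: contrapT => nd; apply: h; exists z, x.
pose v := b + mu * w.
pose J := isum (scale v a) d.
have MJ : is_Omodule O J by apply: isum_module => //; apply: scale_module.
have dJ : subset_of d J.
  by move=> x dx; exists 0, x; rewrite add0r; split=> //; apply: (omod0 (scale_module v Ma)).
have vaJ x : a x -> J (v * x).
  by move=> ax; exists (v * x), 0; rewrite addr0; split=> //; [exists x | apply: (omod0 Md)].
have Omu := mO _ mmu.
have bJ x : a x -> J (b * x).
  move=> ax; have Obx : O (b * x) by rewrite mulrC; apply: aiO.
  (* Both [u * mu] and [mu * (b * x)] lie in [I] and in [m], hence in [d]; what remains is a
     multiple of [v] by an element of [a]. *)
  have -> : b * x = v * (u * x) - u * mu * (x * w) + mu * (b * x).
    by rewrite -{1}[b * x]mul1r {1}e1 /v; ring.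
  apply: (omodD MJ); last first.
    by apply: dJ; apply: Imd; [apply: (omodZ MI Omu (baI x ax)) | apply: (omodZr Mm mmu Obx)].
  apply: (omodB MJ); first by apply: vaJ; apply: (omodZ Ma Ou ax).
  apply: dJ; apply: (omodZr Md); last exact: aiO.
  by apply: Imd; [apply: (omodZr MI Iu Omu) | apply: (omodZ Mm Ou mmu)].
exists v; split.
- by apply: (omodD Mi ib); apply: (omodZ Mi Omu iw).
- by rewrite /v addrC addKr; apply: iprod_mem.
(* Either [J] meets [m] only in [d], which the choice of [w] and [a0] excludes, or [J] contains [m],
   hence [mu], and also [u], hence 1. *)
have [||h|h] := simple _ (cap_module MJ Mm).
- by move=> x dx; split; [apply: dJ | apply: dm].
- by move=> x [].
- case: nd; apply: h; split; last exact: (omodZr Mm mmu (aiO _ _ aa0 iw)).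
  have -> : mu * (a0 * w) = v * a0 - b * a0 by rewrite /v; ring.
  by apply: (omodB MJ); [apply: vaJ | apply: bJ].
- by rewrite -/J e1; apply: (omodD MJ); [apply: bJ | case: (h mu mmu)].
Qed.

(** Induction on the gap in size between the two ideals: an ideal strictly between them splits the
    lift into two shorter ones, and if there is none the quotient is simple. *)
Lemma lift_generator a i d m b :
  is_Omodule O a -> is_Omodule O i -> seteq (iprod a i) O ->
  is_integral_ideal O d -> nonzero_set d -> is_integral_ideal O m -> subset_of d m ->
  i b -> isum (scale b a) m 1 ->
  exists v, [/\ i v, iprod m i (v - b) & isum (scale v a) d 1].
Proof.
move=> Ma Mi ai Id0 nzd; have [sz szP] := ideal_size OO Id0 nzd.
have [n] := ubnP (sz m - sz d)%N.
(* The lower ideal becomes a variable [e] above the fixed [d], because [sz] compares only ideals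
   that contain [d]. *)
have : subset_of d d by [].
move: {-2}d Id0 => e Ie de; elim: n e m b Ie de => // n IH e m b Ie de lt_n Im em ib bm.
have [me|nme] := EM (subset_of m e).
  exists b; split=> //; first by rewrite subrr; apply: iprod0.
  by have [x [y [bx my ->]]] := bm; exists x, y; split=> //; apply: me.
have dm : subset_of d m by move=> x /de/em.
have [[c [[[Mc ec] cm] [nce nmc]]]|noc] := EM (exists c, ((is_Omodule O c /\ subset_of e c) /\
  subset_of c m) /\ (~ subset_of c e /\ ~ subset_of m c)); last first.
  apply: (lift_generator_simple Ma Mi ai Ie Im em) => // c Mc ec cm.
  have [|nce] := EM (subset_of c e); first by left.
  by have [|nmc] := EM (subset_of m c); [right | case: noc; exists c].
have Ic : is_integral_ideal O c by split=> // x /cm; apply: Im.2.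
have dc : subset_of d c by move=> x /de/ec.
have s1 := szP e c Ic Ie.1 de ec nce.
have s2 := szP c m Im Mc dc cm nmc.
have [|v1 [iv1 mv1 cv1]] := IH c m b Ic dc _ Im cm ib bm; first by lia.
have [|v [iv cv ev]] := IH e c v1 Ie de _ Ic ec iv1 cv1; first by lia.
exists v; split=> //; have -> : v - b = (v - v1) + (v1 - b) by ring.
by apply: iprodD mv1; apply: (iprodS cm) cv.
Qed.

(** For [v] in the inverse [i] of [a], the ideal [v a] is integral, and it is coprime to [d] when
    [v] generates [i] modulo [d i]. The presentation [(a1 : b1)] yields a generator [b] modulo [m i]
    that is 1 modulo [m]; it is lifted and then made positive. *)
Lemma move_coprime m Sig d a :
  is_integral_ideal O m -> is_integral_ideal O d -> nonzero_set d -> subset_of d m ->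
  real_at Sig -> Jstar O m a ->
  exists v, [/\ v != 0, congr1 O m v, pos_at Sig v &
    is_integral_ideal O (scale v a) /\ isum (scale v a) d 1].
Proof.
move=> Im Id nzd dm RS [[[Ma Fa] [i [[Mi Fi] ai]]] [a1 [b1 [Ia1 Ib1 Jb1 [a1m b1m acol]]]]].
have O1 := subring1 RO; have /seteqP aiE := ai; have /seteqP aE := acol.
have aiO x y : a x -> i y -> O (x * y) by move=> ax iy; rewrite -aiE; apply: iprod_mem.
have nza : nonzero_set a := invertible_nonzero O1 ai.
have nzi : nonzero_set i by apply: (@invertible_nonzero _ O i a); rewrite // iprodC.
have nzm : nonzero_set m by case: nzd => x [/dm mx x0]; exists x.
have nzb1 : nonzero_set b1.
  by case: Jb1 => _ [b' [_ bb']]; apply: (invertible_nonzero O1 bb').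
have nza1 : nonzero_set a1.
  have [x [ax x0]] := nza; have [y [b_y y0]] := nzb1; exists (x * y).
  by rewrite mulf_neq0 //; split=> //; move: ax; rewrite aE; apply.
have a1a x : a1 x -> a x.
  by move=> ax; rewrite aE => y /Ib1.2 Oy; apply: (omodZr Ia1.1 ax Oy).
have [al [aal al0 mal]] := coprime_elt Ia1 Im nza1 nzm ((a1m 1).2 O1).
have [b [bb b0 mb]] := coprime_elt Ib1 Im nzb1 nzm ((b1m 1).2 O1).
have Mm := Im.1.
(* [b a] lies in [a1], hence in [O]; multiplying by [i] puts [b] in [i]. *)
have ib : i b.
  have : iprod (scale b a) i b by rewrite iprod_scalel aiE; exists 1; rewrite mulr1.
  have sbO : subset_of (scale b a) O.
    by move=> _ [x [ax ->]]; apply: Ia1.2; rewrite mulrC; move: ax; rewrite aE; apply.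
  by move=> /(iprodS sbO (fun x (ix : i x) => ix)); rewrite iprod_idl.
have Oal : O al := Ia1.2 _ aal.
have bm : isum (scale b a) m 1.
  exists (b * al), (1 - b * al); split; last by ring.
    by exists al; split=> //; apply: a1a.
  have -> : 1 - b * al = (1 - al) + al * (1 - b) by ring.
  by apply: (omodD Mm mal); apply: (omodZ Mm Oal mb).
have [v0 [iv0 mv0 dv0]] := lift_generator Ma Mi ai Id nzd Im dm ib bm.
have Mdi : is_Omodule O (iprod d i) := iprod_module i Id.1.
have nzdi : nonzero_set (iprod d i).
  have [x [dx x0]] := nzd; have [y [iy y0]] := nzi; exists (x * y).
  by rewrite mulf_neq0 //; split=> //; apply: iprod_mem.
(* The constant [false] asks for positive signs. A change of [v0] within [d i] alters its products
   with [a] only by elements of [d]. *)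
have [v [vn0 vv0 vs]] := sign_approx (fun=> false) v0 OO Mdi nzdi RS.
have dii : subset_of (iprod d i) i.
  by apply: (iprod_le Mi) => x y dx iy; apply: (omodZ Mi (Id.2 _ dx) iy).
have iv : i v by rewrite -[v](subrK v0); apply: (omodD Mi (dii _ vv0) iv0).
exists v; split=> //.
(* [al] is the denominator: it is 1 modulo [m] and lies in [a], so it carries [m i] into [m]. *)
- apply/congr1P => //; exists al; first exact: Sm_near1.
  have -> : al * (v - 1) = al * (v - b) + al * (b - 1) by ring.
  apply: (omodD Mm); last by apply: (omodZ Mm Oal); rewrite -opprB; apply: (omodN Mm).
  have : iprod m i (v - b).
    by rewrite -(subrKA v0); apply: iprodD mv0; apply: (iprodS dm) vv0.
  move: (v - b); apply: iprod_sub => [|x y mx my|x y mx iy].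
  + by rewrite mulr0; apply: (omod0 Mm).
  + by rewrite mulrDr; apply: (omodD Mm).
  + by rewrite mulrCA; apply: (omodZr Mm mx); apply: aiO iy; apply: a1a.
- by move=> rho Sr; rewrite (sign_pos RS Sr) // vs.
split.
  split; first exact: scale_module.
  by move=> _ [x [ax ->]]; rewrite mulrC; apply: aiO.
have [_ [dl [[x [ax ->]] ddl e1]]] := dv0.
exists (v * x), (dl - (v - v0) * x); split; first by exists x.
  apply: (omodB Id.1 ddl); move: vv0; move: (v - v0).
  apply: iprod_sub => [|t t' dt dt'|t t' dt it'].
  - by rewrite mul0r; apply: (omod0 Id.1).
  - by rewrite mulrDl; apply: (omodD Id.1).
  - by rewrite -mulrA; apply: (omodZr Id.1 dt); rewrite mulrC; apply: aiO.
by rewrite e1; ring.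
Qed.

End Moving.

(** * Contraction to [O] of [O']-ideals coprime to [d] *)

Section Contraction.
Variables (K : fieldExtType rat) (O O' d : K -> Prop).
Hypotheses (RO : is_subring O) (RO' : is_subring O') (sO : subset_of O O').
Hypotheses (Id : is_integral_ideal O' d) (dO : subset_of d O).
Implicit Types (I J a m : K -> Prop) (x y z al be : K).

Definition contr I : K -> Prop := fun x => I x /\ O x.

Let MO : is_Omodule O O := subring_module RO.
Let MO' : is_Omodule O' O' := subring_module RO'.
Let Md : is_Omodule O' d := Id.1.

Lemma contr_ideal I : is_Omodule O' I -> is_integral_ideal O (contr I).
Proof.
by move=> MI; split=> [|x []//]; apply: cap_module MO; apply: omod_restrict MI.
Qed.

Lemma near1_mem x : d (1 - x) -> O x.
Proof.
by move=> dx; rewrite -[x](subKr 1); apply: (omodB MO) (dO dx); apply: subring1.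
Qed.

Lemma isum1P I : isum I d 1 -> exists u, [/\ contr I u & d (1 - u)].
Proof.
move=> [u [v [Iu dv e]]]; have du : d (1 - u) by rewrite e addrAC subrr add0r.
by exists u; split=> //; split=> //; apply: near1_mem.
Qed.

Lemma contr_coprime I : isum I d 1 -> isum (contr I) d 1.
Proof.
by move=> /isum1P[u [Iu du]]; exists u, (1 - u); split=> //; rewrite addrC subrK.
Qed.

(* Multiply by [1 = (u + dl) (v + ep)] with [u] in [I], [v] in [J], [dl] and [ep] in [d]. *)
Lemma contr_iprod I J : is_integral_ideal O' I -> is_integral_ideal O' J ->
  isum I d 1 -> isum J d 1 -> iprod (contr I) (contr J) = contr (iprod I J).
Proof.
move=> [MI IO] [MJ JO] /isum1P[u [[Iu Ou] du]] /isum1P[v [[Jv Ov] dv]].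
apply: subset_anti => [x cx|x [IJx Ox]].
  split; first by apply: iprodS cx => ? [].
  by apply: (iprod_le MO) cx => y z [_ Oy] [_ Oz]; apply: (omodZ MO Oy Oz).
have Ix : I x by apply: (iprod_le MI) IJx => y z Iy /JO; apply: (omodZr MI).
have Jx : J x by apply: (iprod_le MJ) IJx => y z /IO Iy; apply: (omodZ MJ).
have O'x := sO Ox.
have -> : x = x * u * v + u * (x * (1 - v)) + x * (1 - u) * v
  + (1 - u) * (1 - v) * x by ring.
have Md1 t s : O' t -> d s -> O (t * s) by move=> Ot ds; apply: dO; apply: (omodZ Md).
apply: iprodD; first apply: iprodD; first apply: iprodD.
- apply: iprod_mem; split=> //; last by apply: (omodZ MO).
  by apply: (omodZ MI).
- apply: iprod_mem; split=> //; last by apply: Md1.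
  by apply: (omodZr MJ) => //; apply/sO/dO.
- apply: iprod_mem; split=> //; last by apply: Md1.
  by apply: (omodZr MI) => //; apply/sO/dO.
move: x IJx {Ox Ix Jx O'x}; apply: iprod_sub => [|x y|x y Ix Jy].
- by rewrite mulr0; apply: iprod0.
- by rewrite [_ * (x + y)]mulrDr; apply: iprodD.
have -> : (1 - u) * (1 - v) * (x * y) = (x * (1 - u)) * (y * (1 - v)) by ring.
apply: iprod_mem; split.
- by apply: (omodZr MI) => //; apply/sO/dO.
- by apply: Md1 => //; apply: IO.
- by apply: (omodZr MJ) => //; apply/sO/dO.
- by apply: Md1 => //; apply: JO.
Qed.

(** With [u] in [contr I] and [1 - u] in [d], write [x = u x + x (1 - u)]: the second term lies in
    [I] and in [d], hence in [contr I]. *)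
Lemma contr_ext I : is_Omodule O' I -> subset_of I O' -> isum I d 1 ->
  iprod (contr I) O' = I.
Proof.
move=> MI IO /isum1P[u [[Iu Ou] du]]; apply: subset_anti => [|x Ix].
  by apply: (iprod_le MI) => x y [Ix _] Oy; apply: (omodZr MI).
have -> : x = u * x + (x * (1 - u)) * 1 by ring.
apply: iprodD; apply: iprod_mem; rewrite /contr; first by [].
- exact: IO.
- split; first by apply: (omodZr MI) => //; apply/sO/dO.
  by apply: dO; apply: (omodZ Md) => //; apply: IO.
- exact: subring1.
Qed.

(** With [1 = b + dl], an element [x] of [a O'] and [O] is [x b + dl x]; the first term is in [a],
    and [dl] carries [a O'] into [a] because [d O'] lies in [O]. *)
Lemma contr_of_ext a : is_integral_ideal O a -> isum a d 1 -> contr (iprod a O') = a.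
Proof.
move=> [Ma aO] [b [dl [ab ddl e]]]; apply: subset_anti => [x [ax Ox]|x ax]; last first.
  split; last exact: aO.
  by rewrite -[x]mulr1; apply: iprod_mem => //; apply: subring1.
have -> : x = x * b + dl * x by rewrite -[LHS]mulr1 e; ring.
apply: (omodD Ma); first exact: (omodZ Ma).
move: x ax {Ox}; apply: iprod_sub => [|x y|x y ax Oy].
- by rewrite mulr0; apply: (omod0 Ma).
- by rewrite mulrDr; apply: (omodD Ma).
- by rewrite mulrCA; apply: (omodZr Ma ax); apply: dO; apply: (omodZr Md).
Qed.

Lemma contr_principal n : n != 0 -> d (1 - n) -> contr (scale n O') = scale n O.
Proof.
move=> n0 dn; have On := near1_mem dn; apply: subset_anti => [_ [[t [Ot ->]] Ont]|_ [t [Ot ->]]].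
  exists t; split=> //; have -> : t = n * t + t * (1 - n) by ring.
  by apply: (omodD MO Ont); apply: dO; apply: (omodZ Md).
by split; [exists t; split=> //; apply: sO | apply: (omodZ MO)].
Qed.

(* If [n] in [I] is congruent to [1] modulo [d] then [J = n I^-1] is integral and coprime
   to [d], so that the contractions of [I] and [J] multiply to [n O]. *)
Lemma contr_invertible I : nonzero_set d -> is_integral_ideal O' I -> is_invertible O' I ->
  isum I d 1 -> is_invertible O (contr I).
Proof.
move=> nzd Ii [_ [I' [[MI' _] II']]] Id1.
split; first exact/integral_fractional/contr_ideal/Ii.1.
have O1 := subring1 RO'; have /seteqP II'E := II'.
have [n [In n0 dn]] := coprime_elt Ii Id (invertible_nonzero O1 II') nzd Id1.
(* As [I] is integral, its inverse contains 1, so [n] lies in [n I'] and makes it coprime to [d]. *)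
have I'1 : I' 1.
  have : iprod I I' 1 by rewrite II'E.
  by move/(iprodS Ii.2 (fun x (h : I' x) => h)); rewrite iprod_idl.
have IJ : is_integral_ideal O' (scale n I').
  split; first exact: scale_module.
  by move=> _ [x [I'x ->]]; rewrite -II'E; apply: iprod_mem.
have Jd : isum (scale n I') d 1.
  by exists n, (1 - n); split=> //; [exists 1; rewrite mulr1 | rewrite addrC subrK].
exists (scale n^-1 (contr (scale n I'))); split.
  apply: fractional_scale; first by rewrite invr_eq0.
  exact/integral_fractional/contr_ideal/IJ.1.
apply/seteqP; rewrite iprod_scaler contr_iprod // iprod_scaler II'E.
by rewrite contr_principal // scaleK.
Qed.

Lemma contr_Jstar m I : is_integral_ideal O m -> subset_of d m -> nonzero_set d ->
  is_integral_ideal O' I -> is_invertible O' I -> isum I d 1 -> Jstar O m (contr I).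
Proof.
move=> Im dm nzd Ii Ji Id1; apply: Jstar_integral => //.
- exact: contr_ideal Ii.1.
- exact: contr_invertible.
have [x [y [cx dy e]]] := contr_coprime Id1.
by exists x, y; split=> //; apply: dm.
Qed.

(** Being nonzero is asked separately: when [d] is the whole ring, 0 is a unit modulo [d] but
    generates no invertible ideal. *)
Definition residue_unit al := [/\ O' al, al != 0 & exists y, O' y /\ d (al * y - 1)].

Lemma residue_unitM al be : residue_unit al -> residue_unit be -> residue_unit (al * be).
Proof.
move=> [Oa a0 [y [Oy dy]]] [Ob b0 [z [Oz dz]]]; split; rewrite ?mulf_neq0 //.
  exact: (omodZ MO').
exists (y * z); split; first exact: (omodZ MO').
have -> : al * be * (y * z) - 1 = (be * z) * (al * y - 1) + (be * z - 1) by ring.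
by apply: (omodD Md) dz; apply: (omodZ Md) dy; apply: (omodZ MO').
Qed.

Lemma principal_ideal al : O' al -> is_integral_ideal O' (scale al O').
Proof.
move=> Oal; split; first exact: scale_module.
by move=> _ [x [Ox ->]]; apply: (omodZ MO').
Qed.

Lemma principal_invertible al : al != 0 -> is_invertible O' (scale al O').
Proof. by move=> al0; apply/invertible_scale/order_invertible. Qed.

Lemma principal_coprime al : residue_unit al -> isum (scale al O') d 1.
Proof.
move=> [Oal al0 [y [Oy dy]]]; exists (al * y), (- (al * y - 1)).
by split; [exists y | apply: (omodN Md) | ring].
Qed.

Lemma principalM al be : iprod (scale al O') (scale be O') = scale (al * be) O'.
Proof.
by rewrite iprod_scalel iprod_scaler iprod_idl ?scaleA //; apply: subring1.
Qed.

Lemma contr_principalM al be : residue_unit al -> residue_unit be ->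
  iprod (contr (scale al O')) (contr (scale be O')) = contr (scale (al * be) O').
Proof.
move=> Ra Rb; have [Oa _ _] := Ra; have [Ob _ _] := Rb.
by rewrite contr_iprod ?principalM //; apply: principal_ideal || apply: principal_coprime.
Qed.

(** The scalar is [be / al]. As [z] is invertible modulo [d] within [O], for [t] in [O'] the product
    [al * t] lies in [O] exactly when [be * t] does. *)
Lemma contr_eqv m Sig al be z : is_integral_ideal O m -> subset_of d m -> nonzero_set d ->
  real_at Sig -> residue_unit al -> residue_unit be -> res_unit O d m z ->
  d (be - al * z) -> (forall rho, Sig rho -> (rho al < 0) = (rho be < 0)) ->
  ray_eqv O m Sig (contr (scale be O')) (contr (scale al O')).
Proof.
move=> Im dm nzd RS Ra [Ob b0 _] [Oz [z' [Oz' dz]] [mu [dl [mmu ddl e]]]] dbe sgn.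
have [Oa a0 _] := Ra; have Mm := Im.1.
have mz : m (z - 1) by rewrite e; apply: (omodD Mm mmu); apply: dm.
exists (be / al); split.
- by rewrite mulf_neq0 ?invr_eq0.
- have nzI : nonzero_set (scale al O').
    by exists al; split=> //; exists 1; rewrite mulr1; split=> //; apply: subring1.
  (* An element [al * y] that is 1 modulo [d] is the denominator showing that [be / al] is congruent
     to 1. *)
  have [_ [[y [Oy ->]] n0 dn]] :=
    coprime_elt (principal_ideal Oa) Id nzI nzd (principal_coprime Ra).
  have On := near1_mem dn.
  apply/congr1P=> //; exists (al * y); first by apply: Sm_near1 => //; apply: dm.
  have -> : al * y * (be / al - 1) = y * (be - al * z) + al * y * (z - 1).
    have -> : al * y * (be / al - 1) = (al / al) * be * y - al * y by ring.
    by rewrite divff //; ring.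
  by apply: (omodD Mm); [apply: dm; apply: (omodZ Md) | apply: (omodZ Mm)].
- move=> rho Sr; rewrite (sign_pos RS Sr) ?mulf_neq0 ?invr_eq0 //.
  rewrite (sign_mul RS Sr) ?invr_eq0 // fmorphV invr_lt0 sgn //.
  by case: (rho be < 0).
apply/seteqP; apply: subset_anti.
  move=> _ [[t [Ot ->]] Obt]; exists (al * t); split; last first.
    by rewrite mulrA divfK.
  split; first by exists t.
  have -> : al * t = z' * (be * t) - (z' * t) * (be - al * z) - (al * t) * (z * z' - 1) by ring.
  have O'z' := sO Oz'.
  apply: (omodB MO); first apply: (omodB MO); first exact: (omodZ MO).
    by apply: dO; apply: (omodZ Md) => //; apply: (omodZ MO').
  by apply: dO; apply: (omodZ Md) => //; apply: (omodZ MO').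
move=> _ [_ [[[t [Ot ->]] Oat] ->]].
have -> : be / al * (al * t) = be * t by rewrite mulrA divfK.
split; first by exists t.
have -> : be * t = t * (be - al * z) + z * (al * t) by ring.
by apply: (omodD MO); [apply: dO; apply: (omodZ Md) | apply: (omodZ MO)].
Qed.

End Contraction.

(** * Ray equivalence is an equivalence relation *)

Section RayEquivalence.
Variables (K : fieldExtType rat) (O m : K -> Prop) (Sig : {rmorphism K -> algC} -> Prop).
Hypotheses (RO : is_subring O) (Im : is_integral_ideal O m).
Implicit Types a b c : K -> Prop.

Lemma ray_eqv_refl a : ray_eqv O m Sig a a.
Proof.
exists 1; split; [exact: oner_neq0 | exact: congr1_1 | |by rewrite scale1].
by move=> rho _; rewrite rmorph1.
Qed.

Lemma ray_eqv_sym a b : ray_eqv O m Sig a b -> ray_eqv O m Sig b a.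
Proof.
move=> [al [al0 cal pal /seteqP->]]; exists al^-1; split.
- by rewrite invr_eq0.
- exact: congr1V.
- by move=> rho Sr; rewrite fmorphV invr_gt0; apply: pal.
- by rewrite scaleK.
Qed.

Lemma ray_eqv_trans a b c :
  ray_eqv O m Sig a b -> ray_eqv O m Sig b c -> ray_eqv O m Sig a c.
Proof.
move=> [al [al0 cal pal /seteqP->]] [be [be0 cbe pbe /seteqP->]].
exists (al * be); split; rewrite ?mulf_neq0 ?scaleA //; first exact: congr1M.
by move=> rho Sr; rewrite rmorphM mulr_gt0 ?pal ?pbe.
Qed.

End RayEquivalence.

(** * Extension of ideals from [O] to [O'] *)

Section Extension.
Variables (K : fieldExtType rat) (O O' m m' : K -> Prop).
Variables Sig Sig' : {rmorphism K -> algC} -> Prop.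
Hypotheses (RO : is_subring O) (RO' : is_subring O') (sO : subset_of O O').
Hypotheses (Im : is_integral_ideal O m) (Im' : is_integral_ideal O' m').
Hypotheses (mm' : subset_of m m') (sS : forall rho, Sig' rho -> Sig rho).
Implicit Types a b : K -> Prop.

Let MO' : is_Omodule O' O' := subring_module RO'.

Lemma ext_module a : is_Omodule O' (iprod a O').
Proof. by rewrite iprodC; apply: iprod_module. Qed.

Lemma ext_iprod a b : iprod (iprod a O') (iprod b O') = iprod (iprod a b) O'.
Proof.
by rewrite iprodA [iprod (iprod a O') b]iprodAC -iprodA (iprod_idl (subring1 RO') MO').
Qed.

Lemma ext_order : iprod O O' = O'.
Proof.
apply: subset_anti => [|x Ox].
  by apply: (iprod_le MO') => x y /sO Ox; apply: (omodZ MO').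
by rewrite -[x]mul1r; apply: iprod_mem => //; apply: subring1.
Qed.

Lemma ext_integral a : subset_of a O -> is_integral_ideal O' (iprod a O').
Proof.
move=> aO; split; first exact: ext_module.
by apply: (iprod_le MO') => x y /aO/sO; apply: (omodZ MO').
Qed.

Lemma ext_fractional a : is_fractional O a -> is_fractional O' (iprod a O').
Proof.
move=> [Ma [l [l0 la]]]; split; first exact: ext_module.
exists l; split=> //; apply: iprod_sub => [|x y Ox Oy|x y /la/sO Ox Oy].
- by rewrite mulr0; apply: (omod0 MO').
- by rewrite mulrDr; apply: (omodD MO').
- by rewrite mulrA; apply: (omodZ MO').
Qed.

Lemma ext_invertible a : is_invertible O a -> is_invertible O' (iprod a O').
Proof.
move=> [Fa [b [Fb /seteqP ab]]]; split; first exact: ext_fractional.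
exists (iprod b O'); split; first exact: ext_fractional.
by apply/seteqP; rewrite ext_iprod ab ext_order.
Qed.

Lemma ext_coprime a : is_integral_ideal O a -> seteq (isum a m) O ->
  seteq (isum (iprod a O') m') O'.
Proof.
move=> Ia /(isum_full RO Ia Im)[x [ax mx]].
apply/isum_full => //; first by apply: ext_integral Ia.2.
exists x; split; last exact: mm'.
by rewrite -[x]mulr1; apply: iprod_mem => //; apply: subring1.
Qed.

(** The presentation extends because, for [b1] with inverse [c], the colon [(a1 : b1)] is the
    product [a1 c], and extension respects products. *)
Lemma ext_Jstar a : Jstar O m a -> Jstar O' m' (iprod a O').
Proof.
move=> [Ja [a1 [b1 [Ia1 Ib1 Jb1 [a1m b1m /seteqP aE]]]]].
split; first exact: ext_invertible.
exists (iprod a1 O'), (iprod b1 O'); split.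
- exact: ext_integral Ia1.2.
- exact: ext_integral Ib1.2.
- exact: ext_invertible.
split; [exact: ext_coprime | exact: ext_coprime |].
have [_ [c [[Mc _] /seteqP b1c]]] := Jb1.
have a1c_a : subset_of (iprod a1 c) a.
  rewrite aE => x a1cx y b1y.
  have : iprod (iprod a1 c) b1 (x * y) by apply: iprod_mem.
  by rewrite -iprodA (iprodC c) b1c iprod_idr ?Ia1.1 //; [apply: subring1 | case: Ia1].
apply/seteqP; apply: subset_anti => x.
  move=> ax y b1y; have : iprod (iprod a O') (iprod b1 O') (x * y) by apply: iprod_mem.
  rewrite ext_iprod; apply: iprodS => // u; apply: (iprod_le Ia1.1).
  by move=> v w; rewrite aE; apply.
move=> h.
(* An [x] carrying [b1 O'] into [a1 O'] carries [b1 c O' = O'] into [a1 c O']; applied to 1 this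
   locates [x]. *)
have S : subset_of (iprod (iprod b1 O') (iprod c O'))
    (fun k => iprod (iprod a1 O') (iprod c O') (k * x)).
  apply: iprod_sub => [|u v|u v b1u cv].
  - by rewrite mul0r; apply: iprod0.
  - by rewrite mulrDl; apply: iprodD.
  - by rewrite mulrAC (mulrC u); apply: iprod_mem => //; apply: h.
have := S 1; rewrite !ext_iprod b1c ext_order mul1r => /(_ (subring1 RO')).
exact: iprodS.
Qed.

Lemma ext_ray_eqv a b :
  ray_eqv O m Sig a b -> ray_eqv O' m' Sig' (iprod a O') (iprod b O').
Proof.
move=> [al [al0 cal pal /seteqP->]]; exists al; split=> //.
- exact: (congr1_mono RO Im).
- by move=> rho /sS; apply: pal.
- by rewrite iprod_scalel.
Qed.

End Extension.

(** * Lifts of residue classes with signs *)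

Section ExactSequence.
Variables (K : fieldExtType rat) (O m O' m' d : K -> Prop).
Local Notation emb := {rmorphism K -> algC}.
Variables Sig Sig' : emb -> Prop.
Hypotheses (OO : is_order O) (Im : is_integral_ideal O m) (RS : real_at Sig).
Hypotheses (OO' : is_order O') (Im' : is_integral_ideal O' m').
Hypotheses (sO : subset_of O O') (mm : subset_of (iprod m O') m').
Hypothesis sS : forall rho, Sig' rho -> Sig rho.
Hypotheses (Id : is_integral_ideal O' d) (nzd : nonzero_set d).
Hypothesis dcol : subset_of d (colon m O').

Let RO := order_subring OO.
Let RO' := order_subring OO'.
Let MO' : is_Omodule O' O' := subring_module RO'.
Let Md : is_Omodule O' d := Id.1.

Let dm : subset_of d m.
Proof. by move=> x /dcol/(_ 1 (subring1 RO')); rewrite mulr1. Qed.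
Let dO : subset_of d O. Proof. by move=> x /dm; apply: Im.2. Qed.
Let mm' : subset_of m m'.
Proof. by move=> x mx; rewrite -[x]mulr1; apply/mm/iprod_mem => //; apply: subring1. Qed.
Let dm' : subset_of d m'. Proof. by move=> x /dm/mm'. Qed.
Let IdO : is_integral_ideal O d. Proof. by split=> //; apply: omod_restrict Md. Qed.
Let RS' : real_at Sig'. Proof. by move=> rho /sS; apply: RS. Qed.

Local Notation contr := (contr O).

Let res_m z : res_unit O d m z -> m (z - 1).
Proof. by move=> [_ _ [x [y [mx /dm my ->]]]]; apply: (omodD Im.1). Qed.

Let res_unitI z : O z -> (exists w, O w /\ d (z * w - 1)) -> m (z - 1) -> res_unit O d m z.
Proof.
move=> Oz wP mz; split=> //; exists (z - 1), 0; rewrite addr0; split=> //.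
exact: (omod0 Md).
Qed.

Let res_unit1 : res_unit O d m 1.
Proof.
apply: res_unitI; first exact: subring1; last by rewrite subrr; apply: (omod0 Im.1).
by exists 1; rewrite mulr1 subrr; split; [apply: subring1 | apply: (omod0 Md)].
Qed.

Definition unit_signs (u : K) : K * (emb -> bool) := (u, fun rho : emb => rho u < 0).

(** The conjunct on [Sig'] forces positive values there; when [p.1] is 1 modulo [m'], this makes
    [al O'] trivial in the ray class group of [O']. *)
Definition lift_of (p : K * (emb -> bool)) (al : K) :=
  [/\ al != 0, d (al - p.1) &
      forall rho, Sig rho -> (rho al < 0) = p.2 rho && ~~ `[< Sig' rho >]].

Lemma lift_exists p : exists al, lift_of p al.
Proof. exact: sign_approx OO' Md nzd RS. Qed.

Section Lift.
Variables (p : K * (emb -> bool)) (al : K).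
Hypotheses (mp : res_unit O' d m' p.1) (lp : lift_of p al).

Lemma lift_residue_unit : residue_unit O' d al.
Proof.
have [Op [y [Oy dy]] _] := mp; have [al0 da _] := lp; split=> //.
  by rewrite -[al](subrK p.1); apply: (omodD MO') Op; apply: Id.2.
exists y; split=> //; have -> : al * y - 1 = y * (al - p.1) + (p.1 * y - 1) by ring.
by apply: (omodD Md) dy; apply: (omodZ Md).
Qed.

Lemma lift_near1 : m' (al - 1).
Proof.
have [_ _ [x [y [mx /dm' my e]]]] := mp; have [_ /dm' da _] := lp.
have -> : al - 1 = (al - p.1) + (p.1 - 1) by ring.
by rewrite e; apply: (omodD Im'.1) => //; apply: (omodD Im'.1).
Qed.

Lemma lift_pos : pos_at Sig' al.
Proof.
have [al0 _ sgn] := lp => rho S'r; rewrite (sign_pos RS' S'r) // (sgn _ (sS S'r)).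
by rewrite negb_and negbK; apply/orP; right; apply/asboolP.
Qed.

Lemma lift_Jstar : Jstar O m (contr (scale al O')).
Proof.
have R := lift_residue_unit; have [Oal al0 _] := R.
apply: (contr_Jstar RO RO' sO Id) => //.
- exact: principal_ideal.
- exact: principal_invertible.
- exact: principal_coprime.
Qed.

Lemma ext_lift : iprod (contr (scale al O')) O' = scale al O'.
Proof.
have R := lift_residue_unit; have [Oal al0 _] := R.
have [Mal alO] := principal_ideal RO' Oal.
by apply: (contr_ext RO RO' sO Id dO) => //; apply: principal_coprime.
Qed.

Lemma lift_eqv be z : residue_unit O' d be -> res_unit O d m z -> d (be - p.1 * z) ->
  (forall rho, Sig rho -> (rho al < 0) = (rho be < 0)) ->
  ray_eqv O m Sig (contr (scale be O')) (contr (scale al O')).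
Proof.
move=> Rb Rz db sgn; apply: (contr_eqv RO RO' sO Id dO Im dm nzd RS _ Rb Rz) => //.
  exact: lift_residue_unit.
have -> : be - al * z = (be - p.1 * z) - z * (al - p.1) by ring.
have [Oz _ _] := Rz; have [_ da _] := lp.
by apply: (omodB Md db); apply: (omodZ Md); first exact: sO.
Qed.

End Lift.

(** * The three maps and their exactness *)

Variable A : K * (emb -> bool) -> K.
Hypothesis AP : forall p, lift_of p (A p).

(** The class does not depend on the choice [A]: two lifts of a member agree modulo [d] and in their
    signs on [Sig], so [lift_eqv] applies with [z = 1]. *)
Definition connecting (p : K * (emb -> bool)) := contr (scale (A p) O').
Definition extension (a : K -> Prop) := iprod a O'.

Local Notation GU := (G_units O m Sig O' m' Sig').
Local Notation GR := (G_res O m Sig O' m' Sig' d).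

Lemma unit_residue u : USunits O' m' Sig' u -> res_unit O' d m' u.
Proof.
move=> [[[Ou u0 Ov] mu] _]; split=> //.
  by exists u^-1; rewrite divff // subrr; split=> //; apply: (omod0 Md).
by exists (u - 1), 0; rewrite addr0; split=> //; apply: (omod0 Md).
Qed.

Lemma unit_signs_hom : @is_hom GU GR unit_signs.
Proof.
split=> [u /= /unit_residue//|u v /= Hu Hv|u v /= Hu Hv].
  move=> [[[Oz z0 Oz'] mz] pz]; have [[[_ u0 _] _] _] := Hu; have [[[_ v0 _] _] _] := Hv.
  split; last first.
    move=> rho Sr _; have := pz _ Sr; rewrite (sign_pos RS Sr) //.
    rewrite (sign_mul RS Sr) ?invr_eq0 // fmorphV invr_lt0.
    by case: (rho u < 0) (rho v < 0) => [] [].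
  exists (u / v); split.
    apply: res_unitI => //; exists (u / v)^-1; split=> //.
    by rewrite divff // subrr; apply: (omod0 Md).
  by rewrite mulrCA divff // mulr1 subrr; apply: (omod0 Md).
have [[[_ u0 _] _] _] := Hu; have [[[_ v0 _] _] _] := Hv; split.
  by exists 1; rewrite mulr1 subrr; split=> //; apply: (omod0 Md).
by move=> rho Sr _; rewrite (sign_mul RS Sr).
Qed.

Lemma unit_signs_ker u : USunits O' m' Sig' u ->
  @sg_eqv GR (unit_signs u) (sg_one GR) -> USunits O m Sig (u / 1).
Proof.
move=> [[[Ou u0 Ov] mu] pu] /= [[z [Rz]]]; rewrite mul1r divr1 => dz sgn.
have [Oz [w [Ow dw]] _] := Rz; have mz := res_m Rz.
have OuO : O u by rewrite -[u](subrK z); apply: (omodD (subring_module RO)) Oz; apply: dO.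
split; last first.
  move=> rho Sr; have [/pu//|nS'] := EM (Sig' rho).
  by rewrite (sign_pos RS Sr) // sgn.
split; last first.
  have -> : u - 1 = (u - z) + (z - 1) by ring.
  by apply: (omodD Im.1) mz; apply: dm.
split=> //.
(* [u] is congruent to [z] and [w] inverts [z], so [u * w] is 1 modulo [d]; thus [u^-1] differs from
   [w] by an element of [d]. *)
have -> : u^-1 = w - u^-1 * ((u - z) * w + (z * w - 1)).
  have -> : (u - z) * w + (z * w - 1) = u * w - 1 by ring.
  by rewrite mulrBr mulKf // mulr1 subKr.
apply: (omodB (subring_module RO) Ow); apply: dO; apply: (omodZ Md Ov).
by apply: (omodD Md _ dw); apply: (omodZr Md dz); apply: sO.
Qed.

Lemma connecting_hom : @is_hom GR (G_cl O m Sig) connecting.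
Proof.
split=> [p /= mp|p q /= mp mq [[z [Rz dz]] sgn]|p q /= mp mq].
- exact: lift_Jstar mp (AP p).
- apply: (lift_eqv mq (AP q) _ Rz); first exact: lift_residue_unit mp (AP p).
    have [_ da _] := AP p; have -> : A p - q.1 * z = (A p - p.1) + (p.1 - q.1 * z) by ring.
    exact: (omodD Md).
  move=> rho Sr; have [_ _ ->//] := AP p; have [_ _ ->//] := AP q.
  by case: asboolP => [|nS'] /=; rewrite ?andbF ?andbT // sgn.
have Rp := lift_residue_unit mp (AP p); have Rq := lift_residue_unit mq (AP q).
have [_ dp sp] := AP p; have [_ dq sq] := AP q.
have mpq : res_unit O' d m' (p.1 * q.1).
  have [Op [y [Oy dy]] [a [e [ma de ep]]]] := mp; have [Oq [w [Ow dw]] [b [f [mb df eq]]]] := mq.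
  split; first exact: (omodZ MO').
    exists (y * w); split; first exact: (omodZ MO').
    have -> : p.1 * q.1 * (y * w) - 1 = q.1 * w * (p.1 * y - 1) + (q.1 * w - 1) by ring.
    by apply: (omodD Md) dw; apply: (omodZ Md) dy; apply: (omodZ MO').
  exists (p.1 * b + a), (p.1 * f + e); split.
  - by apply: (omodD Im'.1) ma; apply: (omodZ Im'.1).
  - by apply: (omodD Md) de; apply: (omodZ Md).
  - have -> : p.1 * q.1 - 1 = p.1 * (q.1 - 1) + (p.1 - 1) by ring.
    by rewrite eq [X in _ + X]ep; ring.
rewrite (contr_principalM RO RO' sO Id dO) //.
apply: ray_eqv_sym => //.
(* [A p * A q] is itself a lift of the product, so it is compared with the chosen lift through the
   multiplier 1. *)
apply: (@lift_eqv (p.1 * q.1, fun rho => xorb (p.2 rho) (q.2 rho)) _ mpq (AP _) _ 1) => //.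
- exact: residue_unitM.
- rewrite /= mulr1; have -> : A p * A q - p.1 * q.1 = A q * (A p - p.1) + p.1 * (A q - q.1) by ring.
  have [OAq _ _] := Rq; have [Op _ _] := mp.
  by apply: (omodD Md); apply: (omodZ Md).
- have [_ p0 _] := Rp; have [_ q0 _] := Rq.
  move=> rho Sr; have [_ _ ->//] := AP (p.1 * q.1, fun rho => xorb (p.2 rho) (q.2 rho)).
  rewrite (sign_mul RS Sr) // sp // sq //=.
  by case: (p.2 rho) (q.2 rho) (~~ _) => [] [] [].
Qed.

Lemma extension_hom : @is_hom (G_cl O m Sig) (G_cl O' m' Sig') extension.
Proof.
split=> [a /=|a b /= _ _|a b /= _ _].
- exact: ext_Jstar.
- exact: ext_ray_eqv.
- by rewrite /extension ext_iprod //; apply: ray_eqv_refl.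
Qed.

(** If [A p O'] contracts to [la O], the quotient [v] of [A p] by [la] is a unit of [O']; it is a
    preimage since [la] is 1 modulo [m] and positive on [Sig]. Conversely, a unit [u] has
    [u O' = O'], which contracts to [O]. *)
Lemma exact_at_residues p : res_unit O' d m' p.1 ->
  (ray_eqv O m Sig (connecting p) O <->
   exists u, USunits O' m' Sig' u /\ @sg_eqv GR (unit_signs u) p).
Proof.
move=> mp; have lp := AP p; have Rp := lift_residue_unit mp lp.
have [Oal al0 _] := Rp; have [_ dal sal] := lp; split; last first.
  move=> [u [Hu [[z [Rz /= dz]] /= sgn]]].
  have := unit_residue Hu; have [[[Ou u0 Ov] mu] pu] := Hu => ru.
  have uO : scale u O' = O'.
    apply: subset_anti => [_ [x [Ox ->]]|x Ox]; first exact: (omodZ MO').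
    by apply/scale_mem => //; apply: (omodZr MO').
  have OE : contr O' = O by apply: subset_anti => [x []//|x Ox]; split=> //; apply: sO.
  apply: ray_eqv_sym => //; rewrite -{2}OE -uO.
  apply: (lift_eqv mp lp _ Rz) => //; first by split=> //; have [_ ? _] := ru.
  move=> rho Sr; rewrite sal //; case: asboolP => [S'r|nS'] /=.
    by rewrite andbF lt_gtF // pu.
  by rewrite andbT -sgn.
move=> [la [la0 cla pla /seteqP E]].
have CE x : contr (scale (A p) O') x <-> exists r, O r /\ x = la * r by rewrite -/(connecting p) E.
have OO1 := subring1 RO; have MO := subring_module RO.
have Ola : O la.
  have [_ //] : contr (scale (A p) O') la by apply/CE; exists 1; rewrite mulr1.
have mla : m (la - 1) := congr1_integral RO Im Ola cla.
(* Both [n] and [A p * (1 - n)] lie in the contraction, hence in [la O]; together they exhibit [A p]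
   as a multiple of [la] in [O']. *)
have [n [Cn dn]] := isum1P RO dO (principal_coprime Id Rp).
have [r1 [Or1 en]] := (CE n).1 Cn.
have [r2 [Or2 er2]] : exists r, O r /\ A p * (1 - n) = la * r.
  apply/CE; have dA : d (A p * (1 - n)) by apply: (omodZ Md).
  by split; [exists (1 - n); split=> //; apply: Id.2 | apply: dO].
pose v := r1 * A p + r2.
have Av : A p = la * v.
  have -> : A p = n * A p + A p * (1 - n) by ring.
  by rewrite er2 en /v; ring.
have v0 : v != 0 by apply: contraNneq al0 => v0; rewrite Av v0 mulr0.
have Ov : O' v by apply: (omodD MO'); [apply: (omodZ MO') => //; apply: sO | apply: sO].
have [_ [y [Oy ey]]] : contr (scale (A p) O') la /\ exists y, O' y /\ la = A p * y.
  have C : contr (scale (A p) O') la by apply/CE; exists 1; rewrite mulr1.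
  by split=> //; case: C.
have vy : v * y = 1 by apply: (mulfI la0); rewrite mulrA -Av -ey mulr1.
have Hv : USunits O' m' Sig' v.
  split; last first.
    move=> rho S'r; have := lift_pos lp S'r; rewrite Av rmorphM pmulr_rgt0 //.
    exact/pla/sS.
  split; first by split=> //; rewrite -[v^-1]mulr1 -vy mulKf.
  have -> : v - 1 = (A p - 1) - v * (la - 1) by rewrite {1}Av; ring.
  by apply: (omodB Im'.1 (lift_near1 mp lp)); apply: (omodZ Im'.1 Ov); apply: mm'.
(* [r1] inverts [la] modulo [d]; it represents the element of [U_m(O/d)] by which [v] and [p.1]
   differ. *)
have d1 : d (r1 * la - 1) by rewrite mulrC -en -opprB; apply: (omodN Md).
exists v; split=> //=; split; last first.
  move=> rho Sr nS'; have := sal _ Sr; rewrite Av rmorphM pmulr_rlt0 ?pla // => ->.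
  by case: asboolP => //; rewrite andbT.
exists r1; split.
  apply: res_unitI => //; first by exists la.
  have -> : r1 - 1 = (r1 * la - 1) - r1 * (la - 1) by ring.
  by apply: (omodB Im.1 (dm d1)); apply: (omodZ Im.1).
have -> : v - p.1 * r1 = r1 * (A p - p.1) - v * (r1 * la - 1) by rewrite Av; ring.
by apply: (omodB Md); apply: (omodZ Md) => //; apply: sO.
Qed.

(** One way, the contraction of [A p O'] extends back to [A p O'], which is trivial. The other way,
    [a] is moved to an integral ideal coprime to [d], which is the contraction of its extension;
    that extension is principal, and its generator [be] provides the residue and the signs. *)
Lemma exact_at_class a : Jstar O m a ->
  (ray_eqv O' m' Sig' (extension a) O' <->
   exists p, res_unit O' d m' p.1 /\ ray_eqv O m Sig (connecting p) a).
Proof.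
move=> Ja; split=> [[la [la0 cla pla /seteqP E]]|[p [mp epa]]]; last first.
  have lp := AP p; have [al0 _ _] := lp.
  apply: (@ray_eqv_trans _ _ _ _ RO' Im' _ (extension (connecting p))).
    by apply: (@ext_ray_eqv _ O O' m m' Sig) => //; apply: ray_eqv_sym.
  rewrite /extension (ext_lift mp lp); exists (A p); split=> //; last exact: lift_pos lp.
  apply/congr1P => //; exists 1; first exact: Sm1.
  by rewrite mul1r; apply: lift_near1 mp lp.
have [v [v0 cv pv [Iv dv]]] := move_coprime OO Im IdO nzd dm RS Ja.
pose be := v * la.
have be0 : be != 0 by rewrite mulf_neq0.
have vE : iprod (scale v a) O' = scale be O' by rewrite iprod_scalel -/(extension a) E scaleA.
have vC : scale v a = contr (scale be O').
  by rewrite -vE (contr_of_ext RO' Id dO).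
have [x [y [vx dy e1]]] := dv.
have [t [Ot ext]] : scale be O' x by rewrite -vE -[x]mulr1; apply: iprod_mem => //; apply: subring1.
have Obe : O' be.
  have : iprod (scale v a) O' be by rewrite vE; exists 1; rewrite mulr1;
    split=> //; apply: subring1.
  by apply: (ext_integral RO' sO Iv.2).2.
have Rbe : residue_unit O' d be.
  split=> //; exists t; split=> //; rewrite -ext e1.
  by rewrite opprD addrA subrr add0r; apply: (omodN Md).
have cbe : congr1 O' m' be.
  by apply: congr1M => //; apply: (congr1_mono RO Im).
have mbe : m' (be - 1) := congr1_integral RO' Im' Obe cbe.
pose p := unit_signs be.
have mp : res_unit O' d m' p.1.
  split=> //; first by case: Rbe.
  by exists (be - 1), 0; rewrite addr0; split=> //; apply: (omod0 Md).
exists p; split=> //.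
apply: (@ray_eqv_trans _ _ _ _ RO Im _ (scale v a)); last by exists v.
rewrite vC; apply: ray_eqv_sym => //; apply: (lift_eqv mp (AP p) Rbe res_unit1).
  by rewrite mulr1 subrr; apply: (omod0 Md).
move=> rho Sr; have [_ _ ->//] := AP p; case: asboolP => [S'r|nS'] /=; last by rewrite andbT.
rewrite andbF lt_gtF // rmorphM mulr_gt0 //; last exact: pla.
by apply: pv.
Qed.

(** The class of [b] contains an integral ideal coprime to [d], and its contraction extends back to
    it. *)
Lemma extension_surj b : Jstar O' m' b ->
  exists a, Jstar O m a /\ ray_eqv O' m' Sig' (extension a) b.
Proof.
move=> Jb; have [v [v0 cv pv [Iv dv]]] := move_coprime OO' Im' Id nzd dm' RS' Jb.
exists (contr (scale v b)); split.
  apply: (contr_Jstar RO RO' sO Id) => //.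
  by apply: invertible_scale => //; case: Jb.
rewrite /extension (contr_ext RO RO' sO Id dO) //; last by case: Iv.
  by exists v.
by case: Iv.
Qed.

End ExactSequence.

Theorem theorem6p5 (K : fieldExtType rat)
    (O m : K -> Prop) (Sig : {rmorphism K -> algC} -> Prop)
    (O' m' : K -> Prop) (Sig' : {rmorphism K -> algC} -> Prop)
    (d : K -> Prop) :
  level_datum O m Sig -> level_datum O' m' Sig' ->
  subset_of O O' -> subset_of (iprod m O') m' ->
  (forall rho, Sig' rho -> Sig rho) ->
  is_integral_ideal O' d -> nonzero_set d -> subset_of d (colon m O') ->
  exists (f1 : K -> K * ({rmorphism K -> algC} -> bool))
         (f2 : K * ({rmorphism K -> algC} -> bool) -> (K -> Prop))
         (f3 : (K -> Prop) -> (K -> Prop)),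
    @exact_seq4 (G_units O m Sig O' m' Sig') (G_res O m Sig O' m' Sig' d)
      (G_cl O m Sig) (G_cl O' m' Sig') f1 f2 f3.
Proof.
move=> [OO Im _ RS] [OO' Im' _ _] sO mm sS Id nzd dcol.
(* Every pair has a lift, member or not, so the choice is a total function. *)
have [A AP] := choice (lift_exists Sig' RS OO' Id nzd).
exists (@unit_signs K), (connecting O O' A), (extension O').
split.
- exact: unit_signs_hom.
- exact: connecting_hom.
- exact: extension_hom.
split.
- exact: unit_signs_ker.
- exact: exact_at_residues.
- exact: exact_at_class.
- exact: (extension_surj OO Im RS OO' Im' sO mm sS Id nzd dcol).
Qed.
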